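(* Let $\mathcal A$ be a finite central free arrangement over an arbitrary field, with underlying matroid $M=M(\mathcal A)$. (1) If $F_1,F_2$ are flats of $M$ with $F_1\cup F_2=E(M)$, then they form a modular pair in $M$. (2) Suppose that $M$ is binary and $3$-connected, and that $(Y_1,Y_2)$ is an exact $3$-separation of $M$ with $|Y_1|,|Y_2|\ge 4$. Put $F_i=\operatorname{cl}_M(Y_i)$ for $i=1,2$ and $T=F_1\cap F_2$. Then $T$ is a three-point line (a flat of rank two with exactly three elements), it is modular in both $M|F_1$ and $M|F_2$, and $M=P_T(M|F_1,M|F_2)$, where $P_T$ denotes the modular join (equivalently, the generalized parallel connection) along $T$. Moreover, $F_1$ and $F_2$ are proper flats of $M$, and each $M|F_i$ is the underlying matroid of a free localization of $\mathcal A$.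
   Context: Arrangements. A finite central arrangement $\mathcal A$ over a field $\mathbb K$ is a finite set of (distinct) linear hyperplanes in an $\ell$-dimensional $\mathbb K$-vector space $V$. For each $H\in\mathcal A$ choose $\alpha_H\in V^*$ with $H=\ker\alpha_H$. Let $S=\operatorname{Sym}(V^* )\cong\mathbb K[x_1,\dots,x_\ell]$ and $\operatorname{Der}_{\mathbb K}(S)=\bigoplus_{i=1}^{\ell}S\,\partial/\partial x_i$. The module of logarithmic derivations is $D(\mathcal A)=\{\theta\in\operatorname{Der}_{\mathbb K}(S):\theta(\alpha_H)\in\alpha_HS\text{ for every }H\in\mathcal A\}$, and $\mathcal A$ is free if $D(\mathcal A)$ is a free $S$-module. The underlying matroid $M(\mathcal A)$ is the (simple) matroid on $\mathcal A$ with $\operatorname{rk}(\mathcal B)=\dim_{\mathbb K}\operatorname{span}\{\alpha_H:H\in\mathcal B\}$. For a subspace $X\subseteq V$, the localization of $\mathcal A$ at $X$ is the arrangement $\mathcal A_X=\{H\in\mathcal A:X\subseteq H\}$ in $V$. For a flat $F$ of $M(\mathcal A)$ and $X_F=\bigcap_{H\in F}H$, one has $\mathcal A_{X_F}=F$ as a set of hyperplanes and $M(\mathcal A_{X_F})=M(\mathcal A)|F$. Matroids. $\operatorname{cl}_M$, $\operatorname{rk}_M$ denote closure and rank; $M|X$ is restriction. A matroid is binary if it is representable over $\mathbb F_2$. Two flats $X,Y$ form a modular pair if $\operatorname{rk}_M(X)+\operatorname{rk}_M(Y)=\operatorname{rk}_M(X\cap Y)+\operatorname{rk}_M(\operatorname{cl}_M(X\cup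 Y))$; a flat is modular if it forms a modular pair with every flat. For $Y\subseteq E(M)$ put $\lambda_M(Y)=\operatorname{rk}_M(Y)+\operatorname{rk}_M(E(M)\setminus Y)-\operatorname{rk}_M(E(M))$. A partition $(Y_1,Y_2)$ of $E(M)$ is a $k$-separation ($k\ge1$) if $|Y_1|,|Y_2|\ge k$ and $\lambda_M(Y_1)\le k-1$; it is exact if $\lambda_M(Y_1)=k-1$. $M$ is $n$-connected if it has no $k$-separation for $k<n$. Modular join. If matroids $N_1,N_2$ on $E_1,E_2$ satisfy $N_1|X=N_2|X$ for $X=E_1\cap E_2$, and $X$ is a modular flat of both, then the modular join $P_X(N_1,N_2)$ is the matroid on $E_1\cup E_2$ whose flats are exactly the subsets $Z$ such that $Z\cap E_i$ is a flat of $N_i$ for $i=1,2$. *)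

(* Defs.v *)
From HB Require Import structures.
From mathcomp Require Import all_boot all_order all_algebra.
From mathcomp Require Import finmap.
From mathcomp Require Import mpoly.

Set Implicit Arguments.
Unset Strict Implicit.
Unset Printing Implicit Defensive.

Import GRing.Theory.

Local Open Scope fset_scope.

(* A matroid whose ground set is a finite subset of [T], given by its rank
   function.  Values of [rk] outside subsets of [ground] are irrelevant, so
   equality of matroids is [eq_matroid] rather than Leibniz equality. *)
Record matroid (T : choiceType) := Matroid {
  ground : {fset T};
  rk : {fset T} -> nat;
  rk_card : forall X, X `<=` ground -> rk X <= #|` X|;
  rk_mono : forall X Y, X `<=` Y -> Y `<=` ground -> rk X <= rk Y;
  rk_submod : forall X Y, X `<=` ground -> Y `<=` ground ->
    (rk (X `|` Y) + rk (X `&` Y) <= rk X + rk Y)%N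
}.

Section Matroids.
Variable T : choiceType.
Implicit Types (M N : matroid T) (X Y Z F : {fset T}).

Definition eq_matroid M N : Prop :=
  ground M = ground N /\ forall X, X `<=` ground M -> rk M X = rk N X.

Definition cl M X : {fset T} := [fset e in ground M | rk M (e |` X) == rk M X].

Definition flat M F : Prop := F `<=` ground M /\ cl M F = F.

Lemma restr_card M X Y : Y `<=` X `&` ground M -> rk M Y <= #|` Y|.
Proof.
by move=> sYX; apply: rk_card; apply: fsubset_trans sYX (fsubsetIr _ _).
Qed.

Lemma restr_mono M X Y Z :
  Y `<=` Z -> Z `<=` X `&` ground M -> rk M Y <= rk M Z.
Proof.
move=> sYZ sZX; apply: rk_mono => //.
exact: fsubset_trans sZX (fsubsetIr _ _).
Qed.

Lemma restr_submod M X Y Z :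
  Y `<=` X `&` ground M -> Z `<=` X `&` ground M ->
  (rk M (Y `|` Z) + rk M (Y `&` Z) <= rk M Y + rk M Z)%N.
Proof.
move=> sYX sZX; apply: rk_submod.
  exact: fsubset_trans sYX (fsubsetIr _ _).
exact: fsubset_trans sZX (fsubsetIr _ _).
Qed.

Definition restr M X : matroid T :=
  @Matroid T (X `&` ground M) (rk M)
    (@restr_card M X) (@restr_mono M X) (@restr_submod M X).

Definition modular_pair M X Y : Prop :=
  [/\ flat M X, flat M Y &
      (rk M X + rk M Y = rk M (X `&` Y) + rk M (cl M (X `|` Y)))%N].

Definition modular_flat M X : Prop :=
  flat M X /\ forall Y, flat M Y -> modular_pair M X Y.

(* The subtraction in [nat] is exact on subsets of the ground set, by
   submodularity. *)
Definition lambda M Y : nat :=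
  (rk M Y + rk M (ground M `\` Y) - rk M (ground M))%N.

Definition separation M k Y1 Y2 : Prop :=
  [/\ 1 <= k,
      Y1 `|` Y2 = ground M /\ Y1 `&` Y2 = fset0,
      k <= #|` Y1|, k <= #|` Y2| & lambda M Y1 <= k.-1].

Definition exact_separation M k Y1 Y2 : Prop :=
  separation M k Y1 Y2 /\ lambda M Y1 = k.-1.

Definition n_connected M n : Prop :=
  forall k Y1 Y2, k < n -> ~ separation M k Y1 Y2.

Definition three_point_line M F : Prop :=
  [/\ flat M F, rk M F = 2 & #|` F| = 3].

(* [M] is the modular join of [N1] and [N2] along [X], including the
   conditions on [N1], [N2] and [X] under which the join is defined; a matroid
   is determined by its ground set and its flats. *)
Definition is_modular_join M X N1 N2 : Prop :=
  [/\ ground N1 `&` ground N2 = X,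
      eq_matroid (restr N1 X) (restr N2 X),
      modular_flat N1 X /\ modular_flat N2 X,
      ground M = ground N1 `|` ground N2 &
      forall Z, Z `<=` ground N1 `|` ground N2 ->
        (flat M Z <->
         flat N1 (Z `&` ground N1) /\ flat N2 (Z `&` ground N2))].

End Matroids.

Section LinearMatroid.
Variables (T : choiceType) (K : fieldType) (W : vectType K).
Variables (E : {fset T}) (f : T -> W).

Definition lin_rk (X : {fset T}) : nat := \dim <<[seq f e | e <- X]>>.

Lemma lin_rk_card X : X `<=` E -> lin_rk X <= #|` X|.
Proof.
by move=> _; apply: leq_trans (dim_span _) _; rewrite size_map.
Qed.

Lemma lin_rk_mono X Y : X `<=` Y -> Y `<=` E -> lin_rk X <= lin_rk Y.
Proof.
move=> /fsubsetP sXY _; apply: dimvS; apply: sub_span => v /mapP[e eX ->].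
by apply: map_f; apply: sXY.
Qed.

Lemma lin_rk_submod X Y : X `<=` E -> Y `<=` E ->
  (lin_rk (X `|` Y) + lin_rk (X `&` Y) <= lin_rk X + lin_rk Y)%N.
Proof.
move=> _ _; rewrite /lin_rk -[leqRHS]dimv_sum_cap -span_cat.
apply: leq_add; apply: dimvS.
  apply: sub_span => v /mapP[e]; rewrite in_fsetU mem_cat => /orP[] eX ->;
    by rewrite (map_f f eX) ?orbT.
rewrite subv_cap; apply/andP; split; apply: sub_span => v /mapP[e];
  by rewrite in_fsetI => /andP[eX eY] ->; apply: map_f.
Qed.

Definition linear_matroid : matroid T :=
  @Matroid T E lin_rk lin_rk_card lin_rk_mono lin_rk_submod.

End LinearMatroid.

Definition representable (K : fieldType) (T : choiceType) (M : matroid T) :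
    Prop :=
  exists n (f : T -> 'rV[K]_n), eq_matroid M (linear_matroid (ground M) f).

Definition binary (T : choiceType) (M : matroid T) : Prop :=
  representable 'F_2 M.

Local Open Scope ring_scope.

(* [D] is a submodule of [N] with a basis [B] (of any cardinality): every
   finite family of distinct elements of [B] is linearly independent, and [D]
   is the set of finite linear combinations of elements of [B]. *)
Definition free_submodule (R : comNzRingType) (N : lmodType R) (D : N -> Prop) :
    Prop :=
  exists B : N -> Prop,
    (forall (s : seq N) (c : N -> R), uniq s -> (forall x, x \in s -> B x) ->
       \sum_(x <- s) c x *: x = 0 -> forall x, x \in s -> c x = 0) /\
    (forall y, D y <-> exists (s : seq N) (c : N -> R),
       (forall x, x \in s -> B x) /\ y = \sum_(x <- s) c x *: x).

Section Arrangements.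
Variables (K : fieldType) (V : vectType K).

Definition is_hyperplane (H : {vspace V}) : Prop :=
  (\dim H).+1 = \dim {:V}.

Definition central_arrangement (A : {fset {vspace V}}) : Prop :=
  forall H, H \in A -> is_hyperplane H.

(* Sym(V^* ) is identified with the polynomial ring whose variables are the
   coordinates dual to the basis [vbasis {:V}] of [V]. *)
Definition poly_of_form (a : 'Hom(V, K^o)) : {mpoly K[\dim {:V}]} :=
  \sum_(i < \dim {:V}) (a (vbasis {:V})`_i : K) *: 'X_i.

(* The derivation \sum_i theta_i d/dx_i of the polynomial ring is represented
   by the vector of its coefficients theta_i. *)
Definition apply_der n (theta : 'rV[{mpoly K[n]}]_n) (p : {mpoly K[n]}) :
    {mpoly K[n]} :=
  \sum_(i < n) theta 0 i * p^`M(i).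

(* In the following definitions [alpha H] is the chosen linear form with
   kernel [H]. *)
Definition log_der (alpha : {vspace V} -> 'Hom(V, K^o))
    (A : {fset {vspace V}})
    (theta : 'rV[{mpoly K[\dim {:V}]}]_(\dim {:V})) : Prop :=
  forall H, H \in A -> exists q,
    apply_der theta (poly_of_form (alpha H)) = poly_of_form (alpha H) * q.

Definition free_arrangement (alpha : {vspace V} -> 'Hom(V, K^o))
    (A : {fset {vspace V}}) : Prop :=
  free_submodule (log_der alpha A).

Definition arr_matroid (alpha : {vspace V} -> 'Hom(V, K^o))
    (A : {fset {vspace V}}) : matroid {vspace V} :=
  linear_matroid A alpha.

Definition localization (A : {fset {vspace V}}) (X : {vspace V}) :
    {fset {vspace V}} :=
  [fset H in A | (X <= H)%VS]%fset.

End Arrangements.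

(* Main.v *)
(* Write D(X) for the logarithmic derivations of the subarrangement X and Q_X
   for the product of its forms.  If A = F1 u F2 with F1, F2 flats, put
   P1 = Q_(F1 \ F2) and P2 = Q_(F2 \ F1).  Both multiply D(F1 n F2) into
   D(F1) + D(F2), and so does a third element, a nonzerodivisor modulo
   (P1, P2): locally at a hyperplane of F1 \ F2 and one of F2 \ F1 the
   arrangement is Boolean.  Since D(A) = D(F1) n D(F2) is free, the Koszul
   complex of this regular sequence with values in D(A) is acyclic, and so
   D(F1 n F2) = D(F1) + D(F2).  Comparing constant parts gives (1).

   In (2), the flats are a modular pair by (1), so T has rank two.  If T were
   just {a, b}, then, with u dual to a and killing b, the derivation a d/du
   would be a sum of elements of D(F1) and D(F2).  The linear part of one of
   them has distinct eigenvalues at a and b, so that M|F1 or M|F2 is a direct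
   sum separating a from b, against 3-connectedness.  Hence T is a full line
   over the two-element field; as every vector of its span is then 0 or a
   point of T, modularity and the join are linear algebra.

   Localizations of free arrangements are free: translate a basis of D(A) to
   the generic point of the flat, extract homogeneous components, and find
   among them, by multilinearity of the determinant, n elements of D(F) with
   determinant a nonzero multiple of Q_F; they form a basis by Saito's
   criterion. *)
Require Import Defs.
From HB Require Import structures.
From mathcomp Require Import all_boot all_order all_algebra.
From mathcomp Require Import finmap.
From mathcomp Require Import mpoly.
From mathcomp Require Import ring zify.
From Stdlib Require Import Classical_Prop.

Set Implicit Arguments.
Unset Strict Implicit.
Unset Printing Implicit Defensive.

Import GRing.Theory.

Local Open Scope ring_scope.

(** * Linear forms and linear sections *)

Section LinearForms.
Variables (K : fieldType) (n : nat).
Implicit Types (u v w : 'rV[K]_n) (W : {vspace 'rV[K]_n}) (p q : {mpoly K[n]}).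

Definition lform w : {mpoly K[n]} := \sum_i w 0 i *: 'X_i.

Lemma lform_is_linear : linear lform.
Proof.
move=> c u v; rewrite /lform scaler_sumr -big_split; apply: eq_bigr => i _.
by rewrite !mxE scalerDl scalerA.
Qed.

HB.instance Definition _ :=
  GRing.isLinear.Build K 'rV[K]_n {mpoly K[n]} _ lform lform_is_linear.

Lemma lform_delta i : lform (delta_mx 0 i) = 'X_i.
Proof.
rewrite /lform (bigD1 i) //= mxE !eqxx scale1r big1 ?addr0 // => j ji.
by rewrite mxE (negbTE ji) scale0r.
Qed.

Lemma mcoeff_lform w i : (lform w)@_U_(i) = w 0 i.
Proof.
rewrite /lform raddf_sum (bigD1 i) //= mcoeffZ mcoeffX eqxx mulr1.
rewrite big1 ?addr0 // => j ji.
by rewrite mcoeffZ mcoeffX eq_mnm1 (negbTE ji) mulr0.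
Qed.

Lemma lform_eq0 w : (lform w == 0) = (w == 0).
Proof.
apply/eqP/eqP => [w0|->]; last exact: linear0.
by apply/rowP => i; rewrite -mcoeff_lform w0 mcoeff0 mxE.
Qed.

Lemma dhomog_lform w : lform w \is 1.-homog.
Proof.
apply: rpred_sum => i _; apply: dhomogZ.
by rewrite dhomogX /= mdeg1.
Qed.

(* The component of [w] along the complement [W^C]; its vanishing detects
   membership in [W], which plays the role of duality. *)
Definition residue W w := w - projv W w.

Lemma residue_is_linear W : linear (residue W).
Proof. by move=> c u v; rewrite /residue linearP scalerBr opprD addrACA. Qed.

HB.instance Definition _ W := GRing.isLinear.Build K 'rV[K]_n 'rV[K]_n _
  (residue W) (residue_is_linear W).

Lemma residue_eq0 W w : (residue W w == 0) = (w \in W).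
Proof.
rewrite /residue subr_eq0; apply/eqP/idP => [->|/projv_id-> //].
exact: memv_proj.
Qed.

Definition dot u w : K := (u *m w^T) 0 0.

Lemma dotE u w : dot u w = \sum_i u 0 i * w 0 i.
Proof. by rewrite /dot mxE; apply: eq_bigr => i _; rewrite mxE. Qed.

Lemma dotZl c u w : dot (c *: u) w = c * dot u w.
Proof. by rewrite /dot -scalemxAl mxE. Qed.

Lemma dotDl u v w : dot (u + v) w = dot u w + dot v w.
Proof. by rewrite /dot mulmxDl mxE. Qed.

(** As [j] varies, these vectors cut out [W]: each of them pairs to zero with [W], and any form
    outside [W] is nonzero on at least one of them. *)
Definition annihilator W j : 'rV[K]_n :=
  \row_i residue W (delta_mx 0 i) 0 j.

Lemma dot_annihilator W j w : dot (annihilator W j) w = residue W w 0 j.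
Proof.
rewrite dotE {2}[w]row_sum_delta linear_sum summxE; apply: eq_bigr => i _.
by rewrite linearZ !mxE mulrC.
Qed.

Lemma notin_dot W w : w \notin W ->
  exists2 u, dot u w = 1 & {in W, forall v, dot u v = 0}.
Proof.
rewrite -residue_eq0 => /rV0Pn[j nz].
exists ((residue W w 0 j)^-1 *: annihilator W j).
  by rewrite dotZl dot_annihilator mulVf.
move=> v; rewrite -residue_eq0 => /eqP v0.
by rewrite dotZl dot_annihilator v0 [X in _ * X]mxE mulr0.
Qed.

(* The substitution killing exactly the linear forms of [W]; its kernel is
   the prime ideal generated by them. *)
Definition spec W p : {mpoly K[n]} :=
  p \mPo [tuple lform (residue W (delta_mx 0 i)) | i < n].

HB.instance Definition _ W := GRing.RMorphism.copy (spec W)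
  (comp_mpoly [tuple lform (residue W (delta_mx 0 i)) | i < n]).

Lemma specX W i : spec W 'X_i = lform (residue W (delta_mx 0 i)).
Proof. by rewrite /spec comp_mpolyXU -tnth_nth tnth_mktuple. Qed.

Lemma specZ W c p : spec W (c *: p) = c *: spec W p.
Proof. exact: comp_mpolyZ. Qed.

Lemma spec_lform W w : spec W (lform w) = lform (residue W w).
Proof.
rewrite {2}[w]row_sum_delta !linear_sum /lform rmorph_sum; apply: eq_bigr => i _.
by rewrite -[LHS]/(spec W _) specZ specX !linearZ.
Qed.

Lemma spec_lform_eq0 W w : (spec W (lform w) == 0) = (w \in W).
Proof. by rewrite spec_lform lform_eq0 residue_eq0. Qed.

(** Each variable differs from its image under [spec W] by the form of a projection to [W], which
    lies in [I]; the congruence then passes through powers, products and sums. The ideal is a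
    predicate so that one argument serves both one and two generators. *)
Lemma spec_ideal W (I : {mpoly K[n]} -> Prop) :
  I 0 -> (forall p q, I p -> I q -> I (p + q)) -> (forall p q, I q -> I (p * q)) ->
  {in W, forall w, I (lform w)} -> forall p, I (p - spec W p).
Proof.
move=> I0 ID IM IW; elim/mpolyind => [|c m p _ _ IHp].
  by rewrite rmorph0 subr0.
rewrite rmorphD opprD addrACA; apply: (ID) => //.
rewrite /= specZ -scalerBr -mul_mpolyC; apply: (IM).
rewrite mpolyXE_id rmorph_prod.
elim: (index_enum _) => [|i s IHs].
  by rewrite !big_nil subrr.
rewrite !big_cons rmorphXn /= specX.
set a := \prod_(j <- s) _ in IHs *; set b := \prod_(j <- s) _ in IHs *.
have -> x y : x * b - y * a = x * (b - a) + a * (x - y) :> {mpoly K[n]} by ring.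
apply: (ID); first exact: IM.
apply: (IM); rewrite subrXX mulrC; apply: (IM).
rewrite -(lform_delta i) -linearB /residue opprB addrC subrK.
by apply/IW/memv_proj.
Qed.

End LinearForms.

(** * Nonzerodivisors modulo two elements, and products of linear forms *)

Definition regular_mod (R : comNzRingType) (f a b : R) :=
  forall x u v, f * x = a * u + b * v -> exists u' v', x = a * u' + b * v'.

Lemma regular_modC (R : comNzRingType) (f a b : R) :
  regular_mod f a b -> regular_mod f b a.
Proof.
move=> fab x u v; rewrite addrC => /fab[u' [v' ->]].
by exists v', u'; rewrite addrC.
Qed.

(** The quotient by [(a * a', b)] is an extension of the quotient by [(a, b)] by the one by
    [(a', b)]: first [x] is written as [a * u1 + b * v1], then the second hypothesis on [f] is
    applied to [u1]. Coprimality of [a] and [b] allows the cancellation of [a] in between. *)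
Lemma regular_modM (R : idomainType) (f a a' b : R) : a != 0 ->
  (forall y z, a * y = b * z -> exists w, z = a * w) ->
  regular_mod f a b -> regular_mod f a' b -> regular_mod f (a * a') b.
Proof.
move=> a0 cop_ab fab fa'b x u v Ex.
have [|u1 [v1 Ex1]] := fab x (a' * u) v; first by rewrite mulrA.
have [|w Ew] := cop_ab (f * u1 - a' * u) (v - f * v1).
  have: a * (f * u1) + b * (f * v1) = a * (a' * u) + b * v.
    by rewrite [a * (a' * u)]mulrA -Ex Ex1; ring.
  move/eqP; rewrite -subr_eq0 => /eqP E0; apply/eqP; rewrite -subr_eq0.
  by apply/eqP; rewrite -E0; ring.
have [|u2 [v2 Eu1]] := fa'b u1 u w.
  apply: (mulfI a0); apply/eqP; rewrite -subr_eq0; apply/eqP.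
  transitivity (f * (a * u1 + b * v1) - (a * a' * u + b * v) + b * (v - f * v1 - a * w)).
    by ring.
  by rewrite -Ex1 Ex Ew !subrr mulr0 addr0.
by exists u2, (a * v2 + v1); rewrite Ex1 Eu1; ring.
Qed.

Section DefiningPolynomials.
Variables (K : fieldType) (n : nat) (T : choiceType).
Variables (A : {fset T}) (f : T -> 'rV[K]_n).
Implicit Types (e : T) (p q : {mpoly K[n]}) (w : 'rV[K]_n) (s : seq T).

Definition simple_family :=
  {in A, forall e, f e != 0} /\
  {in A &, forall e e', e != e' -> f e \notin <[f e']>%VS}.

Definition defpoly s : {mpoly K[n]} := \prod_(e <- s) lform (f e).

Lemma spec_line_eq0 w p :
  spec <[w]> p = 0 -> exists q, p = lform w * q.
Proof.
move=> p0.
pose I p := exists q, p = lform w * q.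
have: I (p - spec <[w]> p).
  apply: spec_ideal.
  - by exists 0; rewrite mulr0.
  - by move=> _ _ [q1 ->] [q2 ->]; exists (q1 + q2); rewrite mulrDr.
  - by move=> q _ [q1 ->]; exists (q * q1); rewrite mulrCA.
  - move=> _ /vlineP[k ->]; exists k%:MP.
    by rewrite linearZ /= mulrC mul_mpolyC.
by rewrite p0 subr0.
Qed.

Lemma spec_plane_eq0 u v p : spec (<[u]> + <[v]>) p = 0 ->
  exists p1 p2, p = lform u * p1 + lform v * p2.
Proof.
move=> p0; set W := (<[u]> + <[v]>)%VS in p0.
pose I p := exists p1 p2, p = lform u * p1 + lform v * p2.
have: I (p - spec W p).
  apply: spec_ideal.
  - by exists 0, 0; rewrite !mulr0 addr0.
  - move=> _ _ [p1 [p2 ->]] [q1 [q2 ->]]; exists (p1 + q1), (p2 + q2).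
    by ring.
  - by move=> q _ [p1 [p2 ->]]; exists (q * p1), (q * p2); ring.
  - move=> _ /memv_addP[_ /vlineP[k ->] [_ /vlineP[l ->] ->]].
    exists k%:MP, l%:MP.
    by rewrite linearD !linearZ /= ![_ * _%:MP]mulrC !mul_mpolyC.
by rewrite p0 subr0.
Qed.

(** Euclid's lemma without unique factorization: reduction modulo [lform w] lands in a domain, and
    coprimality is expressed by a nonzero specialization of [b]. *)
Lemma lform_coprime w b y z : spec <[w]> b != 0 ->
  lform w * y = b * z -> exists q, z = lform w * q.
Proof.
move=> b0 /(congr1 (spec <[w]>)); rewrite !rmorphM /=.
have /eqP-> : spec <[w]> (lform w) == 0 by rewrite spec_lform_eq0 memv_line.
rewrite mul0r => /esym/eqP; rewrite mulf_eq0 (negbTE b0) => /eqP.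
exact: spec_line_eq0.
Qed.

Lemma spec_defpoly_neq0 (W : {vspace 'rV[K]_n}) s :
  {in s, forall e, f e \notin W} -> spec W (defpoly s) != 0.
Proof.
move=> sW; rewrite rmorph_prod prodf_seq_neq0; apply/allP => e es /=.
by rewrite spec_lform_eq0 sW.
Qed.

Lemma defpoly_dvd s e : e \in s -> exists q, defpoly s = lform (f e) * q.
Proof.
by move=> es; exists (\prod_(i <- rem e s) lform (f i)); rewrite /defpoly (big_rem e).
Qed.

Hypothesis simA : simple_family.

Lemma defpoly_neq0 s : {subset s <= A} -> defpoly s != 0.
Proof.
move=> sA; rewrite prodf_seq_neq0; apply/allP => e /sA eA /=.
by rewrite lform_eq0 simA.1.
Qed.

Lemma spec_line_defpoly e s : e \in A -> {subset s <= A} -> e \notin s ->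
  spec <[f e]> (defpoly s) != 0.
Proof.
move=> eA sA es; apply: spec_defpoly_neq0 => e' e's.
by apply: simA.2 => //; [apply: sA | apply: contraNneq es => <-].
Qed.

Lemma defpoly_dvdn_all s d : {subset s <= A} -> uniq s ->
  {in s, forall e, exists q, d = lform (f e) * q} ->
  exists q, d = defpoly s * q.
Proof.
elim: s => [|e s IHs] sA /=.
  by move=> _ _; exists d; rewrite /defpoly big_nil mul1r.
move=> /andP[es us] dv.
have sA' : {subset s <= A} by move=> x xs; rewrite sA // inE xs orbT.
have [|q Eq] := IHs sA' us; first by move=> x xs; apply: dv; rewrite inE xs orbT.
have [|q1 Eq1] := dv e; first by rewrite mem_head.
have [|q2 Eq2] := @lform_coprime (f e) (defpoly s) q1 q _ (etrans (esym Eq1) Eq).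
  by apply: spec_line_defpoly => //; rewrite sA ?mem_head.
by exists q2; rewrite Eq Eq2 /defpoly big_cons; ring.
Qed.

Lemma defpoly_coprime s1 s2 y z : {subset s1 <= A} -> {subset s2 <= A} ->
    uniq s1 -> ~~ has (mem s1) s2 ->
  defpoly s1 * y = defpoly s2 * z -> exists q, z = defpoly s1 * q.
Proof.
move=> s1A s2A us1 dis E; apply: defpoly_dvdn_all => // e es1.
have [q Eq] := defpoly_dvd es1.
apply: (@lform_coprime _ (defpoly s2) (q * y)).
  by apply: spec_line_defpoly; [apply: s1A | | apply: contra dis => es2; apply/hasP; exists e].
by rewrite -E Eq mulrA.
Qed.

Lemma regular_mod1 (R : comNzRingType) (g b : R) : regular_mod g 1 b.
Proof. by move=> x u v _; exists x, 0; rewrite mul1r mulr0 addr0. Qed.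

Lemma regular_mod_lform g e1 e2 : spec (<[f e1]> + <[f e2]>) g != 0 ->
  regular_mod g (lform (f e1)) (lform (f e2)).
Proof.
set W := (_ + _)%VS => g0 x u v E; apply: spec_plane_eq0 (_ : spec W x = 0).
apply/eqP; have := congr1 (spec W) E; rewrite rmorphD !rmorphM /=.
have /eqP-> : spec W (lform (f e1)) == 0.
  by rewrite spec_lform_eq0 (subvP (addvSl _ _)) ?memv_line.
have /eqP-> : spec W (lform (f e2)) == 0.
  by rewrite spec_lform_eq0 (subvP (addvSr _ _)) ?memv_line.
by rewrite !mul0r addr0 => /eqP; rewrite mulf_eq0 (negbTE g0).
Qed.

(** By [regular_modM] in each argument it is enough to treat one form of [s1] and one of [s2]. These
    generate the kernel of a specialization to a domain, where only the image of [g] matters. *)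
Lemma regular_mod_defpoly g s1 s2 : {subset s1 <= A} -> {subset s2 <= A} ->
    ~~ has (mem s1) s2 ->
    {in s1 & s2, forall e1 e2, spec (<[f e1]> + <[f e2]>) g != 0} ->
  regular_mod g (defpoly s1) (defpoly s2).
Proof.
move=> s1A s2A dis g0.
have lin e1 s : e1 \in s1 -> {subset s <= s2} ->
    regular_mod g (lform (f e1)) (defpoly s).
  move=> es1; elim: s => [|e2 s IHs] ss2.
    by rewrite /defpoly big_nil; apply/regular_modC/regular_mod1.
  have es2 : e2 \in s2 by rewrite ss2 ?mem_head.
  rewrite /defpoly big_cons; apply: regular_modC; apply: regular_modM.
  - by rewrite lform_eq0 simA.1 ?s2A.
  - move=> y z; apply: lform_coprime; rewrite spec_lform_eq0.
    apply: (simA.2 _ _ (s1A _ es1) (s2A _ es2)).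
    by apply: contraNneq dis => e12; apply/hasP; exists e2; rewrite //= -e12.
  - by apply/regular_modC/regular_mod_lform/g0.
  - by apply/regular_modC/IHs => x xs; apply: ss2; rewrite inE xs orbT.
have: {subset s1 <= s1} by [].
elim: {1 3}s1 => [|e s IHs] ss1.
  by rewrite /defpoly big_nil; apply: regular_mod1.
have es1 : e \in s1 by rewrite ss1 ?mem_head.
rewrite /defpoly big_cons; apply: regular_modM.
- by rewrite lform_eq0 simA.1 ?s1A.
- move=> y z; apply: lform_coprime; apply: spec_line_defpoly; rewrite ?s1A //.
  by apply: contra dis => es2; apply/hasP; exists e.
- exact: lin.
- by apply: IHs => x xs; apply: ss1; rewrite inE xs orbT.
Qed.

End DefiningPolynomials.

(** * Logarithmic derivations and Saito's criterion *)

Section LogDerivations.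
Variables (K : fieldType) (n : nat) (T : choiceType).
Variables (A : {fset T}) (f : T -> 'rV[K]_n).
Local Notation S := {mpoly K[n]}.
Implicit Types (e : T) (p q : S) (u w : 'rV[K]_n) (X : {fset T}) (theta : 'rV[S]_n).

(* The derivation [theta] applied to the linear form [lform w]. *)
Definition pairing theta w : S := \sum_i w 0 i *: theta 0 i.

Lemma pairing0 w : pairing 0 w = 0.
Proof. by rewrite /pairing big1 // => i _; rewrite mxE scaler0. Qed.

Lemma pairingD theta1 theta2 w :
  pairing (theta1 + theta2) w = pairing theta1 w + pairing theta2 w.
Proof. by rewrite -big_split; apply: eq_bigr => i _; rewrite mxE scalerDr. Qed.

Lemma pairingZ p theta w : pairing (p *: theta) w = p * pairing theta w.
Proof.
by rewrite mulr_sumr; apply: eq_bigr => i _; rewrite mxE scalerAr.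
Qed.

Lemma pairingB theta1 theta2 w :
  pairing (theta1 - theta2) w = pairing theta1 w - pairing theta2 w.
Proof. by rewrite pairingD -scaleN1r pairingZ mulN1r. Qed.

Lemma pairing_const u w : pairing (map_mx (@mpolyC n K) u) w = (dot u w)%:MP.
Proof.
rewrite /pairing dotE raddf_sum; apply: eq_bigr => i _.
by rewrite mxE /= mpolyCM mulrC mul_mpolyC.
Qed.

Definition logder X theta :=
  forall e, e \in X -> exists q, pairing theta (f e) = lform (f e) * q.

Lemma logder0 X : logder X 0.
Proof. by move=> e _; exists 0; rewrite pairing0 mulr0. Qed.

Lemma logderD X theta1 theta2 :
  logder X theta1 -> logder X theta2 -> logder X (theta1 + theta2).
Proof.
move=> D1 D2 e eX; have [q1 E1] := D1 e eX; have [q2 E2] := D2 e eX.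
by exists (q1 + q2); rewrite pairingD E1 E2 mulrDr.
Qed.

Lemma logderZ X p theta : logder X theta -> logder X (p *: theta).
Proof.
move=> D e eX; have [q E] := D e eX.
by exists (p * q); rewrite pairingZ E mulrCA.
Qed.

Lemma logderB X theta1 theta2 :
  logder X theta1 -> logder X theta2 -> logder X (theta1 - theta2).
Proof. by move=> D1 D2; rewrite -scaleN1r; apply/logderD/logderZ. Qed.

Lemma logder_sub X Y theta : (Y `<=` X)%fset -> logder X theta -> logder Y theta.
Proof. by move=> /fsubsetP sYX D e /sYX/D. Qed.

Lemma logder_mulmx X m (x : 'rV[S]_m) (M : 'M[S]_(m, n)) :
  (forall i, logder X (row i M)) -> logder X (x *m M).
Proof.
move=> DM; rewrite mulmx_sum_row; elim/big_ind: _ => [|y z|i _].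
- exact: logder0.
- exact: logderD.
- exact/logderZ.
Qed.

Lemma logder_defpoly X s theta :
  {in X, forall e, e \in s \/ exists q, pairing theta (f e) = lform (f e) * q} ->
  logder X (defpoly f s *: theta).
Proof.
move=> sX e eX; rewrite pairingZ; case: (sX e eX) => [/(defpoly_dvd f)[q ->]|[q ->]].
  by exists (q * pairing theta (f e)); rewrite mulrA.
by exists (defpoly f s * q); rewrite mulrCA.
Qed.

Hypothesis simA : simple_family A f.

(** At a form [f e], the matrix times the coefficient vector of [f e] is a multiple of
    [lform (f e)]. The adjugate turns this into divisibility of the determinant times a nonzero
    coefficient of [f e]. Distinct forms being coprime, their product divides too. *)
Lemma det_logder X (M : 'M[S]_n) : (X `<=` A)%fset ->
  (forall i, logder X (row i M)) -> exists h, \det M = defpoly f X * h.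
Proof.
move=> /fsubsetP sXA DM; apply: (defpoly_dvdn_all simA) => [//||e eX].
  exact: fset_uniq.
have /rV0Pn[k fk] := simA.1 e (sXA e eX).
have [v Ev] : exists v : 'cV[S]_n,
    M *m (map_mx (@mpolyC n K) (f e))^T = lform (f e) *: v.
  have [v Ev] := fin_all_exists (fun i => DM i e eX).
  exists (\col_i v i); apply/colP => i; rewrite !mxE -Ev.
  by apply: eq_bigr => j _; rewrite !mxE -mul_mpolyC mulrC.
have := congr1 (mulmx (\adj M)) Ev.
rewrite mulmxA mul_adj_mx mul_scalar_mx -scalemxAr => /colP/(_ k).
rewrite !mxE => /(congr1 ( *%R (f e 0 k)^-1%:MP)).
rewrite [\det M * _]mulrC mulrA -mpolyCM mulVf // mpolyC1 mul1r => ->.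
by rewrite mulrCA; eexists.
Qed.

End LogDerivations.

Section LinearCombinations.
Variables (R : comNzRingType) (N : lmodType R).

Lemma lincomb_uniq (s t : seq N) (c : N -> R) : uniq t -> {subset s <= t} ->
  exists c', \sum_(x <- s) c x *: x = \sum_(x <- t) c' x *: x.
Proof.
move=> ut; elim: s => [|y s IHs] st.
  by exists (fun=> 0); rewrite big_nil big1 // => x _; rewrite scale0r.
have [|c' Ec'] := IHs; first by move=> x xs; rewrite st // inE xs orbT.
exists (fun x => c' x + (if x == y then c x else 0)).
under [RHS]eq_bigr do rewrite scalerDl.
rewrite big_cons Ec' big_split addrC /=; congr (_ + _).
rewrite (bigD1_seq y) ?st ?mem_head //= eqxx big1 ?addr0 // => x /negbTE->.
exact: scale0r.
Qed.

End LinearCombinations.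

(** Over the fraction field this is the bound on the rank of a product. *)
Lemma mulmx_scalar_min (R : idomainType) m k (M : 'M[R]_(m, k)) N c :
  c != 0 -> M *m N = c%:M -> (m <= k)%N.
Proof.
move=> c0 /(congr1 (map_mx (@tofrac R))); rewrite map_mxM map_scalar_mx /= => E.
apply: (@mulmx1_min _ _ _ (map_mx (@tofrac R) M) ((tofrac c)^-1 *: map_mx (@tofrac R) N)).
by rewrite -scalemxAr E scale_scalar_mx mulVf // tofrac_eq0.
Qed.

Lemma mulmx_det_inj (R : idomainType) k (M : 'M[R]_k) (x : 'rV_k) :
  \det M != 0 -> x *m M = 0 -> x = 0.
Proof.
move=> dM0 xM; have /rowP dx : \det M *: x = 0.
  by rewrite -mul_mx_scalar -mul_mx_adj mulmxA xM mul0mx.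
by apply/rowP => i; have /eqP := dx i; rewrite !mxE mulf_eq0 (negbTE dM0) => /eqP.
Qed.

Section SaitoCriterion.
Variables (K : fieldType) (n : nat) (T : choiceType).
Variables (A : {fset T}) (f : T -> 'rV[K]_n).
Hypothesis simA : simple_family A f.
Local Notation S := {mpoly K[n]}.
Local Notation Q := (defpoly f A).
Implicit Types (e : T) (p q : S) (theta : 'rV[S]_n).

(** Since [D(A)] contains [Q] times every derivation, finitely many basis elements [s] already
    generate all these multiples. They give matrices with [C *m M = Q%:M]; independence yields
    [M *m C = Q%:M] as well, so both have size [n]. *)
Lemma free_matrix_basis : free_submodule (logder f A) ->
  exists M N : 'M[S]_n, [/\ forall i, logder f A (row i M),
    forall theta, logder f A theta -> exists x, theta = x *m M & N *m M = Q%:M].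
Proof.
case=> B [indB spanB].
have Q0 : Q != 0 by apply: (defpoly_neq0 simA).
have DQ theta : logder f A (Q *: theta).
  by apply: logder_defpoly => e eA; left.
have [ss Hss] := fin_all_exists (fun i => (spanB _).1 (DQ (delta_mx 0 i))).
pose s := undup (flatten [seq ss i | i <- enum 'I_n]).
have sB x : x \in s -> B x.
  rewrite mem_undup => /flatten_mapP[i _ xi].
  by have [c [sB _]] := Hss i; apply: sB.
have us : uniq s by apply: undup_uniq.
have exc i : exists c, Q *: delta_mx 0 i = \sum_(x <- s) c x *: x.
  have [c [_ ->]] := Hss i.
  apply: lincomb_uniq => // x xi; rewrite mem_undup.
  by apply/flatten_mapP; exists i; rewrite ?mem_enum.
have [c Ec] := fin_all_exists exc.
pose m := size s.
pose M : 'M[S]_(m, n) := \matrix_(j < m) s`_j.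
pose C : 'M[S]_(n, m) := \matrix_(i, j) c i s`_j.
have rowM j : row j M = s`_j by rewrite rowK.
have sumM (c' : 'rV[S]_n -> S) :
    \sum_(x <- s) c' x *: x = (\row_(j < m) c' s`_j) *m M.
  rewrite mulmx_sum_row (big_nth 0) big_mkord; apply: eq_bigr => j _.
  by rewrite mxE rowM.
have CM : C *m M = Q%:M.
  apply/row_matrixP => i; rewrite row_mul -scalemx1 linearZ /= row1 Ec sumM.
  by congr (_ *m _); apply/rowP => j; rewrite !mxE.
have indM (x : 'rV[S]_m) : x *m M = 0 -> x = 0.
  move=> xM; pose c' y : S := \sum_(j < m | s`_j == y) x 0 j.
  have Ec' (j : 'I_m) : c' s`_j = x 0 j.
    by rewrite /c' (big_pred1 j) // => i; rewrite nth_uniq.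
  apply/rowP => j; rewrite mxE -Ec'.
  apply: (indB s c' us sB) => [|]; last by rewrite mem_nth.
  rewrite sumM (_ : \row_j _ = x) //; apply/rowP => i.
  by rewrite mxE Ec'.
have MC : M *m C = Q%:M.
  apply/row_matrixP => i; apply/eqP; rewrite -subr_eq0 -linearB /=; apply/eqP.
  apply: indM; rewrite -row_mul mulmxBl -mulmxA CM mul_scalar_mx mul_mx_scalar.
  by rewrite subrr row0.
have gen theta : logder f A theta -> exists x, theta = x *m M.
  case/spanB => t [d [tB ->]].
  have ts : {subset t <= s}.
    move=> y yt; apply/negPn/negP => ys; case/negP: Q0; apply/eqP.
    (* A basis element [y] outside [s] would satisfy the relation [Q *: y = (y *m C) *m M], whose
       coefficient at [y] is nonzero. *)
    pose d' z := if z == y then Q else - \sum_(j < m | s`_j == z) (y *m C) 0 j.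
    suff: d' y = 0 by rewrite /d' eqxx.
    apply: (indB (y :: s)) => [|x||]; rewrite ?mem_head //= ?ys //.
      by rewrite inE => /predU1P[->|/sB //]; apply: tB.
    rewrite big_cons {1}/d' eqxx.
    have -> : \sum_(x <- s) d' x *: x = - ((y *m C) *m M).
      transitivity (\sum_(x <- s) (- \sum_(j < m | s`_j == x) (y *m C) 0 j) *: x).
        rewrite !big_seq; apply: eq_bigr => x xs; rewrite /d'.
        by case: eqP xs ys => // -> ->.
      rewrite sumM -mulNmx; congr (_ *m _); apply/rowP => j.
      by rewrite mxE (big_pred1 j) ?[RHS]mxE // => i; rewrite nth_uniq.
    by rewrite -mulmxA CM mul_mx_scalar subrr.
  have [d' ->] := lincomb_uniq d us ts.
  by rewrite sumM; eexists.
have DM i : logder f A (row i M).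
  rewrite rowM; apply/spanB; exists [:: s`_i], (fun=> 1); split.
    by move=> x; rewrite inE => /eqP->; apply/sB/mem_nth.
  by rewrite big_seq1 scale1r.
have En : m = n.
  by apply/eqP; rewrite eqn_leq (mulmx_scalar_min Q0 CM) (mulmx_scalar_min Q0 MC).
clearbody M C; clear rowM sumM; move: M C CM indM MC gen DM.
by rewrite En => M C CM _ _ gen DM; exists M, C.
Qed.

End SaitoCriterion.

Section SaitoDeterminant.
Variables (K : fieldType) (n : nat) (T : choiceType).
Variables (A : {fset T}) (f : T -> 'rV[K]_n).
Hypothesis simA : simple_family A f.
Local Notation S := {mpoly K[n]}.
Local Notation Q := (defpoly f A).
Implicit Types (e : T) (p q : S) (theta : 'rV[S]_n).

Lemma spec_const (W : {vspace 'rV[K]_n}) c : spec W c%:MP = c%:MP.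
Proof. exact: comp_mpolyC. Qed.

(** Near a generic point of the hyperplane of [e] the arrangement has just this hyperplane, and its
    derivations have an explicit basis. Multiplication by the product of the other forms makes that
    basis logarithmic everywhere without adding a factor [lform (f e)] to the determinant. *)
Lemma det_logder_simple e : e \in A -> exists N : 'M[S]_n,
  (forall i, logder f A (row i N)) /\
  exists r, \det N = lform (f e) * r /\ spec <[f e]> r != 0.
Proof.
move=> eA; have /rV0Pn[k fk] := simA.1 e eA.
pose Qe := defpoly f (A `\ e)%fset.
(* Row [k] is the form times the [k]-th partial derivative; every other row is a constant derivation
   killing the form. The chosen [k] has [f e 0 k] nonzero. *)
pose N0 : 'M[S]_n := \matrix_(i, j)
  if i == k then (j == k)%:R * lform (f e)
  else (f e 0 k *+ (i == j) - f e 0 i *+ (j == k))%:MP.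
have dN0 : \det N0 = lform (f e) * (f e 0 k)%:MP ^+ n.-1.
  rewrite (expand_det_row _ k) (bigD1 k) //= big1 => [|j /negbTE jk]; last first.
    by rewrite mxE eqxx jk !mul0r.
  rewrite mxE !eqxx mul1r addr0; congr (_ * _).
  rewrite /cofactor addnn -signr_odd odd_double expr0 mul1r.
  rewrite -det_scalar; congr (\det _); apply/matrixP => i j.
  rewrite !mxE -![_ == k]eq_sym !(negbTE (neq_lift _ _)) subr0.
  by rewrite (inj_eq lift_inj) raddfMn.
exists (Qe *: N0); split=> [i|]; last first.
  exists (Qe ^+ n * (f e 0 k)%:MP ^+ n.-1).
  rewrite detZ dN0 mulrCA; split=> //; rewrite rmorphM !rmorphXn /= spec_const.
  rewrite mulf_neq0 // expf_neq0 ?mpolyC_eq0 //.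
  apply: (spec_line_defpoly simA) => // [x|]; rewrite !inE.
    by case/andP.
  by rewrite eqxx.
rewrite linearZ /=; apply: logder_defpoly => e' e'A; rewrite !inE e'A andbT.
have [->|] := eqVneq e' e; [right | by left].
have [->|ik] := eqVneq i k.
  exists (f e 0 k)%:MP; rewrite /pairing (bigD1 k) //= big1 => [|j /negbTE jk].
    by rewrite !mxE !eqxx mul1r addr0 mulrC mul_mpolyC.
  by rewrite !mxE eqxx jk mul0r scaler0.
exists 0; rewrite mulr0 /pairing.
under eq_bigr do rewrite !mxE (negbTE ik) -mul_mpolyC -mpolyCM.
rewrite -raddf_sum /=; apply/eqP; rewrite mpolyC_eq0; apply/eqP.
under eq_bigr do rewrite mulrBr !mulrnAr.
rewrite sumrB (bigD1 i) //= eqxx [X in _ + X - _]big1 => [|j /negbTE ji]; last first.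
  by rewrite eq_sym ji.
rewrite addr0 (bigD1 k) //= eqxx [X in _ - (_ + X)]big1 => [|j /negbTE->] //.
by rewrite addr0 mulrC subrr.
Qed.

Lemma cancel_defpoly s g a b : {subset s <= A} ->
  {in s, forall e, spec <[f e]> g != 0} ->
  g * a = defpoly f s * b -> exists a', g * a' = b.
Proof.
elim: s a => [|e s IHs] a sA sg; first by rewrite /defpoly big_nil mul1r; exists a.
rewrite /defpoly big_cons -mulrA => E.
have [a' Ea] := lform_coprime (sg e (mem_head _ _)) (esym E).
apply: (IHs a') => [x xs|x xs|].
- by rewrite sA // inE xs orbT.
- by rewrite sg // inE xs orbT.
have L0 : lform (f e) != 0 by rewrite lform_eq0 simA.1 ?sA ?mem_head.
by apply: (mulfI L0); rewrite -E Ea mulrCA.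
Qed.

(* [N] with rows in [D(A)] and [\det N] not divisible by the square of
   [lform (f e)] shows that no form of [A] divides [\det M / Q]; as
   [\det M] divides a power of [Q], the quotient is a unit. *)
Lemma det_basis (M N : 'M[S]_n) : (forall i, logder f A (row i M)) ->
  (forall theta, logder f A theta -> exists x, theta = x *m M) ->
  N *m M = Q%:M -> exists g g', \det M = Q * g /\ g * g' = 1.
Proof.
move=> DM gen NM; have [g Eg] := det_logder simA (fsubset_refl A) DM.
exists g; have gA : {in A, forall e, spec <[f e]> g != 0}.
  move=> e eA; have [N' [DN' [r [dN' r0]]]] := det_logder_simple eA.
  have [Y EY] := fin_all_exists (fun i => gen _ (DN' i)).
  have {}EY : N' = (\matrix_i Y i) *m M.
    by apply/row_matrixP => i; rewrite row_mul rowK -EY.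
  have [q Eq] := defpoly_dvd f eA.
  have L0 : lform (f e) != 0 by rewrite lform_eq0 simA.1.
  move: dN'; rewrite EY det_mulmx Eg Eq -!mulrA mulrCA => /(mulfI L0) Er.
  by move: r0; rewrite -Er !rmorphM !mulf_eq0 !negb_or => /and3P[].
suff [g' Eg'] : exists g', g * g' = 1 by exists g'.
have [k] : exists k, g * (\det N * Q) = Q ^+ k * 1.
  by exists n; rewrite mulr1 -det_scalar -NM det_mulmx Eg; ring.
elim: k (\det N * Q) => [|m IHm] a; first by rewrite expr0 mulr1; exists a.
rewrite exprS -mulrA => /(cancel_defpoly (fun _ => id) gA)[a' /IHm]; exact.
Qed.

(** Cramer's rule: the coefficients of [theta] on the rows of [N] are the determinants of [N] with
    one row replaced by [theta], divided by [\det N]. By [det_logder] these numerators are multiples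
    of [defpoly f X], so the quotients are polynomials. *)
Lemma saito X (N : 'M[S]_n) c : (X `<=` A)%fset ->
    (forall i, logder f X (row i N)) -> c != 0 -> \det N = defpoly f X * c%:MP ->
  free_submodule (logder f X).
Proof.
move=> sXA DN c0 dN.
have QX0 : defpoly f X != 0 by apply: (defpoly_neq0 simA); apply/fsubsetP.
have dN0 : \det N != 0 by rewrite dN mulf_neq0 ?mpolyC_eq0.
have injN (x : 'rV[S]_n) : x *m N = 0 -> x = 0 by apply: mulmx_det_inj.
have rowN_inj : injective (fun i => row i N).
  move=> i j /eqP; rewrite -subr_eq0 ![row _ N]rowE -mulmxBl => /eqP/injN/eqP.
  rewrite subr_eq0 => /eqP/rowP/(_ i); rewrite !mxE !eqxx.
  by case: eqVneq => // _ /eqP; rewrite oner_eq0.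
exists (fun theta => exists i, theta = row i N); split=> [s d us sN s0 x xs|theta].
  have [k Ek] := sN x xs; rewrite {}Ek in xs *.
  pose y : 'rV[S]_n := \row_i (if row i N \in s then d (row i N) else 0).
  have: y = 0.
    apply: injN; rewrite -[RHS]s0 mulmx_sum_row.
    under eq_bigr do rewrite mxE (fun_if ( *:%R^~ _)) scale0r.
    rewrite -big_mkcond /= -(big_map (fun i => row i N) (mem s) (fun x => d x *: x)).
    rewrite -big_filter; apply: perm_big; apply: uniq_perm => //.
      by rewrite filter_uniq // map_inj_uniq // index_enum_uniq.
    move=> z; rewrite mem_filter; apply/andP/idP => [[]//|zs]; split=> //.
    have [i ->] := sN z zs; apply/mapP; exists i => //; exact: mem_index_enum.
  by move/rowP/(_ k); rewrite !mxE xs.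
split=> [Dt|[s [d [sN ->]]]]; last first.
  rewrite big_seq; elim/big_ind: _ => [||z zs]; first exact: logder0.
    by move=> ? ?; apply: logderD.
  by have [i ->] := sN z zs; apply: logderZ.
have exy i : exists y, (theta *m \adj N) 0 i = defpoly f X * y.
  pose N' := \matrix_k (if k == i then theta else row k N).
  have [|h Eh] := @det_logder _ _ _ _ _ simA X N' sXA.
    by move=> k; rewrite rowK; case: eqP.
  exists h; rewrite -Eh (expand_det_row _ i) mxE; apply: eq_bigr => j _.
  rewrite !mxE eqxx; congr (_ * (_ * \det _)); apply/matrixP => k l.
  by rewrite !mxE eq_sym (negbTE (neq_lift _ _)) mxE.
have [y Ey] := fin_all_exists exy.
have Et : theta = (c^-1%:MP *: \row_i y i) *m N.
  suff /rowP E: \det N *: theta = \det N *: ((c^-1%:MP *: \row_i y i) *m N).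
    by apply/rowP => i; apply: (mulfI dN0); have := E i; rewrite !mxE.
  rewrite -mul_mx_scalar -mul_adj_mx mulmxA -scalemxAl scalerA.
  rewrite dN -mulrA -mpolyCM mulfV // mpolyC1 mulr1 scalemxAl; congr (_ *m _).
  by apply/rowP => i; rewrite Ey !mxE.
set x := c^-1%:MP *: _ in Et.
exists [seq row i N | i <- enum 'I_n], (fun z => \sum_(i | row i N == z) x 0 i).
split; first by move=> _ /mapP[i _ ->]; exists i.
rewrite big_map big_enum Et mulmx_sum_row; apply: eq_bigr => i _ /=.
by rewrite (big_pred1 i) // => j; rewrite (inj_eq rowN_inj).
Qed.

End SaitoDeterminant.

(** * Covers by two flats *)

Section Splitting.
Variables (K : fieldType) (n : nat) (T : choiceType).
Variables (A : {fset T}) (f : T -> 'rV[K]_n).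
Hypothesis simA : simple_family A f.
Local Notation S := {mpoly K[n]}.
Implicit Types (e : T) (p q : S) (theta : 'rV[S]_n) (X : {fset T}).

Definition span_of X : {vspace 'rV[K]_n} := <<[seq f e | e <- X]>>%VS.

Definition closed_in X := {in A, forall e, f e \in span_of X -> e \in X}.

Lemma mem_span_of X e : e \in X -> f e \in span_of X.
Proof. by move=> eX; apply/memv_span/map_f. Qed.

(** A nonzero coefficient at [f e2] would put [e2] into the flat. Applied to both flats of a cover,
    this shows that the localization at the codimension two space of [e1] and [e2] is Boolean. *)
Lemma closed_plane X e e1 e2 : {subset X <= A} -> closed_in X ->
    e \in X -> e1 \in X -> e2 \in A -> e2 \notin X ->
  e != e1 -> f e \notin (<[f e1]> + <[f e2]>)%VS.
Proof.
move=> sXA clX eX e1X e2A e2X ne; apply/negP.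
move=> /memv_addP[_ /vlineP[k ->] [_ /vlineP[l ->] Ee]].
have [l0|l0] := eqVneq l 0.
  have := simA.2 _ _ (sXA _ eX) (sXA _ e1X) ne.
  by rewrite Ee l0 scale0r addr0 memvZ ?memv_line.
case/negP: e2X; apply: (clX _ e2A).
have -> : f e2 = l^-1 *: (f e - k *: f e1).
  by rewrite Ee addrC addKr scalerA mulVf ?scale1r.
by apply/memvZ/memvB; [|apply: memvZ]; apply: mem_span_of.
Qed.

Variables F1 F2 : {fset T}.
Hypotheses (FA : (F1 `|` F2 = A)%fset) (cl1 : closed_in F1) (cl2 : closed_in F2).

Let E1 := (F1 `\` F2)%fset.
Let E2 := (F2 `\` F1)%fset.

Definition hyperplane_sum (E : {fset T}) : S := \sum_(e <- E) defpoly f (E `\ e)%fset.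

(* Modulo the ideal of the codimension two space [e1 = e2 = 0], for [e1] in
   [E1] and [e2] in [E2], only one term of each sum survives. *)
Definition third_element : S :=
  defpoly f (F1 `&` F2)%fset * (hyperplane_sum E1 * hyperplane_sum E2).

Let sF1A : {subset F1 <= A}.
Proof. by move=> e eF; rewrite -FA inE eF. Qed.

Let sF2A : {subset F2 <= A}.
Proof. by move=> e eF; rewrite -FA inE eF orbT. Qed.

Lemma spec_hyperplane_sum (E : {fset T}) e (W : {vspace 'rV[K]_n}) : e \in E ->
    f e \in W -> {in E, forall e', e' != e -> f e' \notin W} ->
  spec W (hyperplane_sum E) != 0.
Proof.
move=> eE eW EW; rewrite rmorph_sum (bigD1_seq e) //= big1 ?addr0 => [|e' ne'].
  apply: spec_defpoly_neq0 => e'; rewrite !inE => /andP[ne' e'E].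
  exact: EW.
have [|q ->] := @defpoly_dvd _ _ _ f (E `\ e')%fset e.
  by rewrite !inE eq_sym ne'.
rewrite rmorphM /=; have /eqP-> : spec W (lform (f e)) == 0 by rewrite spec_lform_eq0.
by rewrite mul0r.
Qed.

Lemma spec_third_element e1 e2 : e1 \in E1 -> e2 \in E2 ->
  spec (<[f e1]> + <[f e2]>) third_element != 0.
Proof.
rewrite !inE => /andP[e1F2 e1F1] /andP[e2F1 e2F2].
set W := (_ + _)%VS.
have W1 : f e1 \in W by rewrite (subvP (addvSl _ _)) ?memv_line.
have W2 : f e2 \in W by rewrite (subvP (addvSr _ _)) ?memv_line.
have NW1 e : e \in F1 -> e != e1 -> f e \notin W.
  by move=> eF ne; apply: (closed_plane sF1A) => //; apply: sF2A.
have NW2 e : e \in F2 -> e != e2 -> f e \notin W.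
  by move=> eF ne; rewrite /W addvC; apply: (closed_plane sF2A) => //; apply: sF1A.
rewrite !rmorphM !mulf_neq0 //.
- apply: spec_defpoly_neq0 => e; rewrite inE => /andP[eF1 eF2].
  by apply: NW1 => //; apply: contraNneq e1F2 => <-.
- apply: (spec_hyperplane_sum _ W1); first by rewrite inE e1F2.
  by move=> e; rewrite inE => /andP[_ eF]; apply: NW1.
- apply: (spec_hyperplane_sum _ W2); first by rewrite inE e2F1.
  by move=> e; rewrite inE => /andP[_ eF]; apply: NW2.
Qed.

Definition decomposable theta :=
  exists a b, [/\ logder f F1 a, logder f F2 b & theta = a + b].

Lemma decomposable_sum I (r : seq I) (P : pred I) (F : I -> 'rV[S]_n) :
  (forall i, P i -> decomposable (F i)) -> decomposable (\sum_(i <- r | P i) F i).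
Proof.
move=> dF; elim/big_ind: _ => // [|_ _ [a [b [Da Db ->]]] [c [d [Dc Dd ->]]]].
  by exists 0, 0; rewrite addr0; split=> //; apply: logder0.
exists (a + c), (b + d); split; [exact: logderD | exact: logderD |].
by rewrite addrACA.
Qed.

(** Each term of the expanded product contains all forms except those of one [e1] and one [e2], so
    only these two matter. With [u] dual to [f e1] and killing [f e2], the derivation
    [theta - c *: U] kills [f e1] and [c *: U] kills [f e2]. *)
Lemma third_element_decomposable theta : decomposable (third_element *: theta).
Proof.
rewrite /third_element big_distrlr /= mulr_sumr scaler_suml big_seq.
apply: decomposable_sum => e1; rewrite !inE => /andP[e1F2 e1F1].
rewrite mulr_sumr scaler_suml big_seq.
apply: decomposable_sum => e2; rewrite !inE => /andP[e2F1 e2F2].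
set P0 := defpoly f _; set P1 := defpoly f _; set P2 := defpoly f _.
have [|u u1 u2] := @notin_dot _ _ <[f e2]>%VS (f e1).
  by apply: simA.2; [apply: sF1A | apply: sF2A | apply: contraNneq e1F2 => ->].
have {}u2 : dot u (f e2) = 0 by apply: u2; apply: memv_line.
pose c := pairing theta (f e1); pose U := map_mx (@mpolyC n K) u.
exists ((P0 * (P1 * P2)) *: (theta - c *: U)), ((P0 * (P1 * P2)) *: (c *: U)).
split; last by rewrite -scalerDr subrK.
  have -> : P0 * (P1 * P2) = P2 * (P0 * P1) by ring.
  rewrite -scalerA; apply: logderZ; rewrite /P0 /P1 /defpoly -big_cat.
  apply: logder_defpoly => e eF; rewrite mem_cat !inE eF.
  have [->|_] := eqVneq e e1; last by left; case: (e \in F2).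
  right; exists 0; rewrite pairingB pairingZ pairing_const u1 mulr0.
  by rewrite mulr1 subrr.
have -> : P0 * (P1 * P2) = P1 * (P0 * P2) by ring.
rewrite -scalerA; apply: logderZ; rewrite /P0 /P2 /defpoly -big_cat.
apply: logder_defpoly => e eF; rewrite mem_cat !inE eF.
have [->|_] := eqVneq e e2; last by left; case: (e \in F1).
by right; exists 0; rewrite pairingZ pairing_const u2 !mulr0.
Qed.

(** Write [g_i *: theta] as [a_i + b_i]. The differences [g_j *: a_i - g_i *: a_j] lie in the free
    module [D(A)] and satisfy the Koszul relation with [g1], [g2], [g3]. Regularity makes the first
    of them a boundary: after corrections [d1], [d2] from [D(A)], both [a1 - d1] and [a2 - d2] are
    multiples, by [g1] and [g2], of one derivation [a]. *)
Lemma split_by_regular_sequence (M : 'M[S]_n) theta g1 g2 g3 :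
    (forall theta, logder f A theta -> exists x, theta = x *m M) ->
    (forall x : 'rV[S]_n, x *m M = 0 -> x = 0) ->
    (forall x : 'rV[S]_n, logder f A (x *m M)) ->
    g1 != 0 -> (forall y z, g1 * y = g2 * z -> exists q, z = g1 * q) ->
    regular_mod g3 g1 g2 ->
    decomposable (g1 *: theta) -> decomposable (g2 *: theta) ->
    decomposable (g3 *: theta) ->
  exists a, [/\ logder f F1 (g1 *: a), logder f F1 (g2 *: a),
    logder f F2 (g1 *: (theta - a)) & logder f F2 (g2 *: (theta - a))].
Proof.
move=> genM injM DM g1_0 cop reg [a1 [b1 [Da1 Db1 E1_]]] [a2 [b2 [Da2 Db2 E2_]]].
move=> [a3 [b3 [Da3 Db3 E3_]]].
(* The cocycle [g' a - g a'] lies in [D(F1)], and equals [g b' - g' b] hence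
   also lies in [D(F2)]. *)
have cocycle g g' a b a' b' : logder f F1 a -> logder f F1 a' -> logder f F2 b ->
    logder f F2 b' -> g *: theta = a + b -> g' *: theta = a' + b' ->
    logder f A (g' *: a - g *: a').
  move=> Da Da' Db Db' Eg Eg' e; rewrite -FA inE => /orP[]; last first.
    have -> : g' *: a - g *: a' = g *: b' - g' *: b.
      have -> : a = g *: theta - b by rewrite Eg addrK.
      have -> : a' = g' *: theta - b' by rewrite Eg' addrK.
      by apply/rowP => i; rewrite !mxE; ring.
    by apply: logderB; apply: logderZ.
  by apply: logderB; apply: logderZ.
have [x Ex] := genM _ (cocycle _ _ _ _ _ _ Da1 Da2 Db1 Db2 E1_ E2_).
have [y Ey] := genM _ (cocycle _ _ _ _ _ _ Da2 Da3 Db2 Db3 E2_ E3_).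
have [z Ez] := genM _ (cocycle _ _ _ _ _ _ Da3 Da1 Db3 Db1 E3_ E1_).
have Exyz : g3 *: x = g1 *: (- y) + g2 *: (- z).
  apply/eqP; rewrite -subr_eq0; apply/eqP/injM.
  rewrite mulmxBl mulmxDl -!scalemxAl !mulNmx -Ex -Ey -Ez.
  apply/rowP => i; rewrite !mxE; ring.
have exuv i : exists uv, x 0 i = g1 * uv.1 + g2 * uv.2.
  have /rowP/(_ i) := Exyz; rewrite !mxE => /reg[u [v ->]].
  by exists (u, v).
have [uv Euv] := fin_all_exists exuv.
pose d1 := (\row_i (uv i).2) *m M; pose d2 := - (\row_i (uv i).1) *m M.
have Dd1 : logder f A d1 by apply: DM.
have Dd2 : logder f A d2 by apply: DM.
have Ex' : g2 *: a1 - g1 *: a2 = g2 *: d1 - g1 *: d2.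
  rewrite Ex /d1 /d2 !scalemxAl -mulmxBl; congr (_ *m _).
  by apply/rowP => i; rewrite !mxE Euv; ring.
clearbody d1 d2.
have sd X d : (X `<=` A)%fset -> logder f A d -> logder f X d by apply: logder_sub.
have s1A : (F1 `<=` A)%fset by apply/fsubsetP.
have s2A : (F2 `<=` A)%fset by apply/fsubsetP.
have Ed : g2 *: (a1 - d1) = g1 *: (a2 - d2).
  apply/rowP => i; move/rowP/(_ i): Ex'; rewrite !mxE => Ei.
  transitivity (g2 * a1 0 i - g1 * a2 0 i + g1 * a2 0 i - g2 * d1 0 i); first by ring.
  by rewrite Ei; ring.
have exa i : exists q, (a1 - d1) 0 i = g1 * q.
  apply: (cop ((a2 - d2) 0 i)); have /rowP/(_ i) := Ed.
  by rewrite !mxE.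
have [a Ea] := fin_all_exists exa.
have Ea1 : a1 - d1 = g1 *: \row_i a i by apply/rowP => i; rewrite Ea !mxE.
have Ea2 : a2 - d2 = g2 *: \row_i a i.
  apply/rowP => i; apply: (mulfI g1_0); have /rowP/(_ i) := Ed.
  by rewrite Ea1 !mxE => <-; ring.
exists (\row_i a i); split.
- by rewrite -Ea1; apply: logderB => //; apply: sd.
- by rewrite -Ea2; apply: logderB => //; apply: sd.
- rewrite scalerBr -Ea1 E1_ opprB [a1 + b1]addrC -addrA [a1 + _]addrCA subrr addr0.
  by apply: logderD => //; apply: sd.
- rewrite scalerBr -Ea2 E2_ opprB [a2 + b2]addrC -addrA [a2 + _]addrCA subrr addr0.
  by apply: logderD => //; apply: sd.
Qed.

Lemma has_disjoint (X Y : {fset T}) : (X `&` Y = fset0)%fset -> ~~ has (mem X) Y.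
Proof.
move=> XY; apply/hasPn => e eY; apply/negP => /= eX.
have: e \in (X `&` Y)%fset by rewrite inE eX.
by rewrite XY inE.
Qed.

Lemma logder_cancel X g a : (X `<=` A)%fset ->
  {in X, forall e, spec <[f e]> g != 0} -> logder f X (g *: a) -> logder f X a.
Proof.
move=> sXA gX Da e eX; have [q] := Da e eX; rewrite pairingZ => /esym E.
exact: lform_coprime (gX e eX) E.
Qed.

Theorem free_logder_decomposable theta : free_submodule (logder f A) ->
  logder f (F1 `&` F2)%fset theta -> decomposable theta.
Proof.
move=> freeA Dth; have [M [N [DM gen NM]]] := free_matrix_basis simA freeA.
have [g [g' [dM gg']]] := det_basis simA DM gen NM.
have Q0 : defpoly f A != 0 by apply: (defpoly_neq0 simA).
have g0 : g != 0 by apply/eqP => g0; have /eqP := gg'; rewrite g0 mul0r eq_sym oner_eq0.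
have dM0 : \det M != 0 by rewrite dM mulf_neq0.
have injM (x : 'rV[S]_n) : x *m M = 0 -> x = 0 by apply: mulmx_det_inj.
have sE1 : {subset E1 <= A} by move=> e; rewrite inE => /andP[_ /sF1A].
have sE2 : {subset E2 <= A} by move=> e; rewrite inE => /andP[_ /sF2A].
have disE : (E1 `&` E2 = fset0)%fset.
  by apply/fsetP => e; rewrite !inE; case: (e \in F1); case: (e \in F2).
have [|||||||a [D1 D2 D3 D4]] := @split_by_regular_sequence M theta (defpoly f E1)
    (defpoly f E2) third_element gen injM.
- by move=> x; apply: logder_mulmx.
- exact: (defpoly_neq0 simA).
- move=> y z; apply: (defpoly_coprime simA) => //; exact: has_disjoint.
- apply: (regular_mod_defpoly simA) => //; first exact: has_disjoint.
  exact: spec_third_element.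
- exists (defpoly f E1 *: theta), 0; rewrite addr0; split=> //; last exact: logder0.
  apply: logder_defpoly => e eF; have [eF2|eF2] := boolP (e \in F2).
    by right; apply: Dth; rewrite inE eF.
  by left; rewrite inE eF2.
- exists 0, (defpoly f E2 *: theta); rewrite add0r; split=> //; first exact: logder0.
  apply: logder_defpoly => e eF; have [eF1|eF1] := boolP (e \in F1).
    by right; apply: Dth; rewrite inE eF1.
  by left; rewrite inE eF1.
- exact: third_element_decomposable.
(* The forms of [E2] are coprime to those of [F1], so [defpoly f E2] can be cancelled in [D(F1)];
   likewise [defpoly f E1] in [D(F2)]. *)
exists a, (theta - a); split; last by rewrite addrC subrK.
  apply: (logder_cancel _ _ D2) => [|e eF]; first exact/fsubsetP.
  by apply: (spec_line_defpoly simA) => //; [apply: sF1A | rewrite inE eF].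
apply: (logder_cancel _ _ D3) => [|e eF]; first exact/fsubsetP.
by apply: (spec_line_defpoly simA) => //; [apply: sF2A | rewrite inE eF].
Qed.

End Splitting.

(** * Constant and linear parts of derivations at the origin *)

Section ConstantAndLinearParts.
Variables (K : fieldType) (n : nat) (T : choiceType) (f : T -> 'rV[K]_n).
Local Notation S := {mpoly K[n]}.
Implicit Types (e : T) (p q : S) (u v w : 'rV[K]_n) (theta : 'rV[S]_n).
Implicit Types (X F : {fset T}).

Lemma dot_span u X v :
  {in X, forall e, dot u (f e) = 0} -> v \in span_of f X -> dot u v = 0.
Proof.
move=> uX; pose g := linfun (mulmxr u^T : 'rV[K]_n -> 'rV[K]_1).
have gE w : g w 0 0 = dot u w.
  by rewrite lfunE /dot !mxE; apply: eq_bigr => i _; rewrite !mxE mulrC.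
have: (span_of f X <= lker g)%VS.
  apply/span_subvP => _ /mapP[e eX ->]; rewrite memv_ker; apply/eqP/rowP => i.
  by rewrite ord1 gE uX // mxE.
by move=> /subvP sub /sub; rewrite memv_ker => /eqP/rowP/(_ 0); rewrite gE mxE.
Qed.

Lemma meval0_lform w : (lform w).@[fun=> 0] = 0.
Proof.
rewrite /lform raddf_sum big1 // => i _ /=.
by rewrite mevalZ mevalXU mulr0.
Qed.

Definition const_part theta : 'rV[K]_n := \row_i (theta 0 i).@[fun=> 0].

Lemma const_partD theta1 theta2 :
  const_part (theta1 + theta2) = const_part theta1 + const_part theta2.
Proof. by apply/rowP => i; rewrite !mxE mevalD. Qed.

Lemma dot_const_part theta w :
  dot (const_part theta) w = (pairing theta w).@[fun=> 0].
Proof.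
rewrite dotE raddf_sum; apply: eq_bigr => i _ /=.
by rewrite mevalZ mxE mulrC.
Qed.

(** The origin lies on every hyperplane, so there a logarithmic derivation is a vector tangent to
    all of them. *)
Lemma const_part_logder X theta v :
  logder f X theta -> v \in span_of f X -> dot (const_part theta) v = 0.
Proof.
move=> Dth; apply: dot_span => e eX; rewrite dot_const_part.
by have [q ->] := Dth e eX; rewrite mevalM meval0_lform mul0r.
Qed.

(* The linear part of [theta], as an endomorphism of the space of linear
   forms; for a logarithmic derivation the defining forms are eigenvectors. *)
Definition linear_part theta : 'M[K]_n :=
  \matrix_(i, j) ((theta 0 i)^`M(j)).@[fun=> 0].

Lemma linear_partD theta1 theta2 :
  linear_part (theta1 + theta2) = linear_part theta1 + linear_part theta2.
Proof. by apply/matrixP => i j; rewrite !mxE mderivD mevalD. Qed.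

Lemma mul_linear_part w theta :
  w *m linear_part theta = \row_j ((pairing theta w)^`M(j)).@[fun=> 0].
Proof.
apply/rowP => j; rewrite !mxE /pairing (raddf_sum (mderiv j)) raddf_sum /=; apply: eq_bigr => i _.
by rewrite mxE mderivZ mevalZ.
Qed.

Lemma mderiv_lform w j : (lform w)^`M(j) = (w 0 j)%:MP.
Proof.
rewrite /lform (raddf_sum (mderiv j)) (bigD1 j) //= big1 ?addr0 => [|i ij].
  rewrite mderivZ mderivX mnmE eqxx scale1r -[X in (X - _)%MM]add0m addmK.
  by rewrite mpolyX0 alg_mpolyC.
by rewrite mderivZ mderivX mnmE (negbTE ij) scale0r scaler0.
Qed.

Lemma linear_part_lform w q j :
  ((lform w * q)^`M(j)).@[fun=> 0] = w 0 j * q.@[fun=> 0].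
Proof.
by rewrite mderivM mevalD !mevalM meval0_lform mul0r addr0 mderiv_lform mevalC.
Qed.

Lemma linear_part_logder X theta e : logder f X theta -> e \in X ->
  exists k, f e *m linear_part theta = k *: f e.
Proof.
move=> Dth eX; have [q Eq] := Dth e eX; exists q.@[fun=> 0].
by rewrite mul_linear_part Eq; apply/rowP => j; rewrite !mxE linear_part_lform mulrC.
Qed.

Lemma linear_part_rank1 u v w :
  w *m linear_part (lform v *: map_mx (@mpolyC n K) u) = dot u w *: v.
Proof.
rewrite mul_linear_part pairingZ pairing_const; apply/rowP => j.
by rewrite !mxE linear_part_lform mevalC mulrC.
Qed.

Lemma span_stable (L : 'M[K]_n) (s : seq 'rV[K]_n) v :
  {in s, forall x, exists k, x *m L = k *: x} -> v \in <<s>>%VS -> v *m L \in <<s>>%VS.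
Proof.
move=> sL vs; pose g := linfun (mulmxr L : 'rV[K]_n -> 'rV[K]_n).
have -> : v *m L = g v by rewrite lfunE.
have := memv_img g vs; rewrite limg_span; apply: subvP.
apply/span_subvP => _ /mapP[x xs ->]; rewrite lfunE /=.
by have [k ->] := sL x xs; rewrite memvZ ?memv_span.
Qed.

(** If [x] has eigenvalue [d], then [L - d] maps [v] into the span of the remaining vectors and
    multiplies it by the nonzero scalar [c - d]; hence [v] already lies in the smaller span. *)
Lemma eigen_span_eq0 (L : 'M[K]_n) (s : seq 'rV[K]_n) c v :
  {in s, forall x, exists2 k, x *m L = k *: x & k != c} ->
  v \in <<s>>%VS -> v *m L = c *: v -> v = 0.
Proof.
elim: s => [|x s IHs] sL.
  by rewrite span_nil memv0 => /eqP.
rewrite span_cons => /memv_addP[_ /vlineP[k ->] [w ws Ev]] vL.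
have sL' : {in s, forall x, exists2 k, x *m L = k *: x & k != c}.
  by move=> y ys; apply: sL; rewrite inE ys orbT.
apply: (IHs sL') => //.
have [d xL dc] := sL x (mem_head _ _).
have wL : w *m L \in <<s>>%VS.
  by apply: span_stable ws => y /sL'[j]; exists j.
have Ew : w *m L - d *: w = (c - d) *: v.
  rewrite scalerBl -vL Ev mulmxDl scalerDr -scalemxAl xL !scalerA [k * d]mulrC.
  by rewrite opprD addrACA subrr add0r.
have -> : v = (c - d)^-1 *: (w *m L - d *: w).
  by rewrite Ew scalerA mulVf ?scale1r // subr_eq0 eq_sym.
by apply/memvZ/memvB/memvZ.
Qed.

(** [G] spans part of the eigenspace of [c], while the other forms have eigenvalues different from
    [c]. So the matroid of [F] is the direct sum of its restrictions to [G] and to the complement of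
    [G]. *)
Lemma eigen_split (L : 'M[K]_n) F c :
    {in F, forall e, exists k, f e *m L = k *: f e} ->
  let G := [fset e in F | f e *m L == c *: f e]%fset in
  (span_of f G :&: span_of f (F `\` G)%fset = 0)%VS.
Proof.
move=> FL G; apply/eqP; rewrite -subv0; apply/subvP => v; rewrite memv_cap memv0.
case/andP=> vG vG'; apply/eqP; apply: (eigen_span_eq0 (L := L) (c := c) _ vG').
  move=> x /mapP[e]; rewrite !inE => /andP[neG eF] ->.
  have [k Ek] := FL e eF; exists k => //.
  by apply: contra neG => /eqP kc; rewrite eF Ek kc eqxx.
pose g := linfun (mulmxr (L - c%:M) : 'rV[K]_n -> 'rV[K]_n).
have: (span_of f G <= lker g)%VS.
  apply/span_subvP => x /mapP[e eG ->]; move: eG; rewrite !inE => /andP[_ /eqP eL].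
  by rewrite memv_ker lfunE /= mulmxBr eL mul_mx_scalar subrr.
move=> /subvP/(_ v vG); rewrite memv_ker lfunE /= mulmxBr mul_mx_scalar subr_eq0.
by move/eqP.
Qed.

End ConstantAndLinearParts.

(** * Consequences of the splitting for two flats covering the arrangement *)

Section ModularPairs.
Variables (K : fieldType) (n : nat) (T : choiceType).
Variables (A F1 F2 : {fset T}) (f : T -> 'rV[K]_n).
Hypotheses (simA : simple_family A f) (freeA : free_submodule (logder f A)).
Hypotheses (FA : (F1 `|` F2 = A)%fset).
Hypotheses (cl1 : closed_in A f F1) (cl2 : closed_in A f F2).

(** If [w] lay in both spans but not in that of the common points, some [u] would kill the common
    points and pair to one with [w]. The constant derivation [u] splits over the two flats, and both
    constant parts kill [w]. *)
Lemma span_cap : (span_of f F1 :&: span_of f F2 = span_of f (F1 `&` F2)%fset)%VS.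
Proof.
apply/eqP; rewrite eqEsubv; apply/andP; split; last first.
  rewrite subv_cap; apply/andP; split; apply: sub_span => x /mapP[e];
    by rewrite inE => /andP[e1 e2] ->; apply: map_f.
apply/subvP => w; rewrite memv_cap => /andP[w1 w2]; apply/negPn/negP => w12.
have [u uw u12] := notin_dot w12.
have [|a [b [Da Db Eab]]] := free_logder_decomposable simA FA cl1 cl2
    (theta := map_mx (@mpolyC n K) u) freeA.
  by move=> e eF; exists 0; rewrite pairing_const u12 ?mem_span_of // mulr0.
have Eu : u = const_part a + const_part b.
  by rewrite -const_partD -Eab; apply/rowP => i; rewrite !mxE mevalC.
have /eqP := uw; rewrite Eu dotDl (const_part_logder Da w1) (const_part_logder Db w2).
by rewrite addr0 eq_sym oner_eq0.
Qed.

(* The derivation [lform (f a) d/du], with [u] dual to [f a] and killing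
   [f b], is logarithmic for [{a, b}] and has distinct eigenvalues at [a], [b]. *)
Lemma two_point_intersection a b : (F1 `&` F2 = [fset a; b])%fset -> a != b ->
  exists L1 L2 : 'M[K]_n, [/\ {in F1, forall e, exists k, f e *m L1 = k *: f e},
    {in F2, forall e, exists k, f e *m L2 = k *: f e},
    f a *m (L1 + L2) = f a & f b *m (L1 + L2) = 0].
Proof.
move=> Fab neab.
have [aA bA] : a \in A /\ b \in A.
  have: a \in (F1 `&` F2)%fset /\ b \in (F1 `&` F2)%fset by rewrite Fab !inE !eqxx orbT.
  by rewrite -FA !inE => -[/andP[-> _] /andP[-> _]].
have [u ua ub] := notin_dot (simA.2 _ _ aA bA neab).
have {}ub : dot u (f b) = 0 by apply: ub; apply: memv_line.
have [|th1 [th2 [D1 D2 E]]] := free_logder_decomposable simA FA cl1 cl2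
    (theta := lform (f a) *: map_mx (@mpolyC n K) u) freeA.
  move=> e; rewrite Fab !inE => /orP[]/eqP->; rewrite pairingZ pairing_const.
    by eexists.
  by rewrite ub; exists 0; rewrite !mulr0.
exists (linear_part th1), (linear_part th2); split.
- by move=> e; apply: linear_part_logder.
- by move=> e; apply: linear_part_logder.
- by rewrite -linear_partD -E linear_part_rank1 ua scale1r.
- by rewrite -linear_partD -E linear_part_rank1 ub scale0r.
Qed.

End ModularPairs.

(** * Localizations *)

Section DeterminantIdeal.
Variables (R : comNzRingType) (n : nat).
Variables (J : R -> Prop) (D : 'rV[R]_n -> Prop).
Hypotheses (J0 : J 0) (JD : forall a b, J a -> J b -> J (a + b)).
Hypothesis JM : forall a b, J b -> J (a * b).

(** Linear combinations, built one term at a time so that multilinearity of the determinant applies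
    by induction. *)
Inductive lspan : 'rV[R]_n -> Prop :=
| lspan0 : lspan 0
| lspan_cons c v r : D v -> lspan r -> lspan (c *: v + r).

Lemma lspanD r1 r2 : lspan r1 -> lspan r2 -> lspan (r1 + r2).
Proof.
by elim=> [|c v r Dv _ IH] s2; rewrite ?add0r // -addrA; apply: lspan_cons => //; apply: IH.
Qed.

Lemma lspan_mem c v : D v -> lspan (c *: v).
Proof. by move=> Dv; rewrite -[_ *: _]addr0; apply: lspan_cons => //; apply: lspan0. Qed.

Lemma lspan_sum I (r : seq I) (P : pred I) F :
  (forall i, P i -> lspan (F i)) -> lspan (\sum_(i <- r | P i) F i).
Proof. by move=> sF; elim/big_ind: _ => //; [apply: lspan0 | apply: lspanD]. Qed.

Definition set_row (M : 'M[R]_n) i0 r := \matrix_i (if i == i0 then r else row i M).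

Lemma row_set_row M i0 r i : row i (set_row M i0 r) = if i == i0 then r else row i M.
Proof. exact: rowK. Qed.

Lemma det_set_row_linear M i0 c v r :
  \det (set_row M i0 (c *: v + r)) = c * \det (set_row M i0 v) + \det (set_row M i0 r).
Proof.
rewrite -[\det (set_row M i0 r)]mul1r; apply: (@determinant_multilinear _ _ _ _ _ i0).
- by rewrite !row_set_row eqxx scale1r.
- by apply/matrixP => i j; rewrite !mxE eq_sym (negbTE (neq_lift _ _)).
- by apply/matrixP => i j; rewrite !mxE eq_sym (negbTE (neq_lift _ _)).
Qed.

(** Rows are expanded one after the other: in the induction the rows numbered below [k] are
    combinations and the others belong to [D]. *)
Lemma det_lspan : (forall M : 'M[R]_n, (forall i, D (row i M)) -> J (\det M)) ->
  forall M : 'M[R]_n, (forall i, lspan (row i M)) -> J (\det M).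
Proof.
move=> JD' M sM.
suff Jk k : forall M : 'M[R]_n,
    (forall i : 'I_n, (i < k)%N -> lspan (row i M)) ->
    (forall i : 'I_n, (k <= i)%N -> D (row i M)) -> J (\det M).
  by apply: (Jk n) => // i; rewrite leqNgt ltn_ord.
elim: k => [|k IHk] {sM}M sM DM; first by apply: JD' => i; apply: DM.
have [kn|nk] := ltnP k n; last first.
  by apply: IHk => i ki; [apply: sM; rewrite ltnS ltnW | have := leq_trans nk ki; rewrite leqNgt ltn_ord].
pose i0 := Ordinal kn.
have -> : M = set_row M i0 (row i0 M).
  by apply/row_matrixP => i; rewrite row_set_row; case: eqP => // ->.
have := sM i0 (ltnSn _); move: (row i0 M) => r0.
elim=> [|c v r Dv _ IH].
  rewrite (expand_det_row _ i0) big1 // => j _.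
  by rewrite !mxE eqxx mxE mul0r.
rewrite det_set_row_linear; apply: (JD) => //; apply: JM; apply: IHk => i ki.
  rewrite row_set_row ifN; first by apply: sM; rewrite ltnS ltnW.
  by apply: contraTneq ki => ->; rewrite /= ltnn.
rewrite row_set_row; case: eqVneq => // ne; apply: DM.
by rewrite ltn_neqAle ki andbT eq_sym.
Qed.

End DeterminantIdeal.

(** * Homogeneous components, then translation to the generic point of a flat *)

Section HomogeneousParts.
Variables (K : fieldType) (n : nat) (T : choiceType) (f : T -> 'rV[K]_n).
Local Notation S := {mpoly K[n]}.
Implicit Types (p q : S) (theta : 'rV[S]_n) (X : {fset T}).

Lemma pihomogM k d p q : p \is k.-homog ->
  pihomog mdeg (k + d) (p * q) = p * pihomog mdeg d q.
Proof.
move=> hp; have := leq_maxl (mmeasure mdeg q) d.+1.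
move=> /(pihomog_partitionE (mf := mdeg)) {1}->.
rewrite mulr_sumr raddf_sum /=.
have dlt : (d < maxn (mmeasure mdeg q) d.+1)%N by rewrite leq_maxr.
rewrite (bigD1 (Ordinal dlt)) //= big1 ?addr0 => [|j jd].
  by rewrite pihomog_dE // dhomogM // pihomogP.
apply: (@pihomog_ne0 _ _ _ (k + j)); last by rewrite dhomogM // pihomogP.
by rewrite eqn_add2l; apply: contra jd => /eqP jd; apply/eqP/val_inj.
Qed.

Lemma pihomogM_lt k d p q : p \is k.-homog -> (d < k)%N ->
  pihomog mdeg d (p * q) = 0.
Proof.
move=> hp dk; rewrite [q](pihomog_partitionE (mf := mdeg) (leqnn _)).
rewrite mulr_sumr raddf_sum /= big1 // => j _.
apply: (@pihomog_ne0 _ _ _ (k + j)); last by rewrite dhomogM // pihomogP.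
by rewrite neq_ltn orbC (leq_trans dk) ?leq_addr.
Qed.

Lemma pihomog0_const p : pihomog mdeg 0 p = (p.@[fun=> 0])%:MP.
Proof.
elim/mpolyind: p => [|c m p _ _ IHp]; first by rewrite !raddf0.
rewrite !raddfD /= IHp; congr (_ + _); rewrite linearZ /= pihomogX mdeg_eq0.
rewrite mevalZ mevalX mpolyCM mul_mpolyC; congr (_ *: _).
case: eqVneq => [->|]; first by rewrite mpolyX0 big1 ?mpolyC1 // => i _; rewrite mnmE.
rewrite -mdeg_eq0 mdegE sum_nat_eq0 negb_forall => /existsP[i /= mi].
by rewrite (bigD1 i) //= expr0n (negbTE mi) mul0r mpolyC0.
Qed.

Lemma dhomog_prod_seq (I : Type) (s : seq I) (d : I -> nat) (F : I -> S) :
  (forall i, F i \is (d i).-homog) ->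
  \prod_(i <- s) F i \is (\sum_(i <- s) d i).-homog.
Proof.
move=> hF; elim: s => [|i s IHs]; first by rewrite !big_nil dhomog1.
by rewrite !big_cons dhomogM.
Qed.

Lemma dhomog_defpoly s : defpoly f s \is (size s).-homog.
Proof.
have := @dhomog_prod_seq T s (fun=> 1%N) (fun e => lform (f e)) (fun e => dhomog_lform _).
by rewrite sum1_size.
Qed.

Lemma dhomog_det (M : 'M[S]_n) (d : 'I_n -> nat) :
  (forall i j, M i j \is (d i).-homog) -> \det M \is (\sum_i d i).-homog.
Proof.
move=> hM; apply: rpred_sum => s _; rewrite rpredMsign.
exact: dhomog_prod_seq.
Qed.

Lemma logder_pihomog X d theta :
  logder f X theta -> logder f X (map_mx (pihomog mdeg d) theta).
Proof.
move=> Dth e eX; have [q Eq] := Dth e eX.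
have -> : pairing (map_mx (pihomog mdeg d) theta) (f e) = pihomog mdeg d (pairing theta (f e)).
  by rewrite /pairing raddf_sum; apply: eq_bigr => i _; rewrite mxE /= linearZ.
rewrite Eq; case: d => [|d].
  by exists 0; rewrite (pihomogM_lt _ (dhomog_lform _)) ?mulr0.
by exists (pihomog mdeg d q); rewrite -add1n (pihomogM _ _ (dhomog_lform _)).
Qed.

End HomogeneousParts.

Section Localization.
Variables (K : fieldType) (n : nat) (T : choiceType).
Variables (A F : {fset T}) (f : T -> 'rV[K]_n).
Hypotheses (simA : simple_family A f) (freeA : free_submodule (logder f A)).
Hypotheses (FA : (F `<=` A)%fset) (clF : closed_in A f F).
Local Notation S := {mpoly K[n]}.
Local Notation W := (span_of f F).
Implicit Types (p q : S) (w : 'rV[K]_n) (theta : 'rV[S]_n).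

(* The value of [w] at the generic point [sum_j t^j annihilator W j] of the
   flat, which avoids the other hyperplanes over any field. *)
Definition generic_value w : {poly K} := \poly_(j < n) oapp (residue W w 0) 0 (insub j).

Lemma generic_value_is_linear : linear generic_value.
Proof.
move=> c u v; apply/polyP => j; rewrite coefD coefZ !coef_poly.
case: ltnP => [jn|]; last by rewrite mulr0 addr0.
by rewrite insubT /= linearP !mxE.
Qed.

HB.instance Definition _ := GRing.isLinear.Build K 'rV[K]_n {poly K} _
  generic_value generic_value_is_linear.

Lemma generic_value_eq0 w : (generic_value w == 0) = (w \in W).
Proof.
rewrite -residue_eq0; apply/eqP/eqP => [/polyP w0|w0]; last first.
  by apply/polyP => j; rewrite coef_poly w0 coef0; case: ltnP => // jn; rewrite insubT /= mxE.
apply/rowP => j; have := w0 j; rewrite coef_poly ltn_ord coef0 valK /= => ->.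
by rewrite mxE.
Qed.

(** Substitution of the coordinates shifted by their values at the generic point; the parameter [t]
    of that point is the variable of [{poly S}]. *)
Definition translate : S -> {poly S} :=
  mmap (polyC \o @mpolyC n K)
    (fun i => ('X_i)%:P + map_poly (@mpolyC n K) (generic_value (delta_mx 0 i))).

HB.instance Definition _ := GRing.RMorphism.copy translate
  (mmap (polyC \o @mpolyC n K)
    (fun i => ('X_i)%:P + map_poly (@mpolyC n K) (generic_value (delta_mx 0 i)))).

Lemma translateZ c p : translate (c *: p) = (c%:MP)%:P * translate p.
Proof. exact: mmapZ. Qed.

Lemma translate_lform w :
  translate (lform w) = (lform w)%:P + map_poly (@mpolyC n K) (generic_value w).
Proof.
rewrite {3}[w]row_sum_delta /lform !rmorph_sum linear_sum rmorph_sum -big_split /=.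
apply: eq_bigr => i _; rewrite translateZ /translate mmapX mmap1U.
by rewrite mulrDr -polyCM mul_mpolyC linearZ /= -mul_polyC rmorphM /= map_polyC.
Qed.

Lemma translate_lform_in w : w \in W -> translate (lform w) = (lform w)%:P.
Proof.
by rewrite -generic_value_eq0 translate_lform => /eqP->; rewrite rmorph0 addr0.
Qed.

(** Sets the coordinates to zero and keeps [t]; composed with [translate] it is evaluation at the
    generic point. *)
Definition eval_origin (P : {poly S}) : {poly K} := map_poly (meval (fun=> 0)) P.

HB.instance Definition _ := GRing.RMorphism.copy eval_origin
  (map_poly (meval (fun=> 0 : K))).

Lemma eval_origin_lform w : eval_origin (translate (lform w)) = generic_value w.
Proof.
rewrite translate_lform rmorphD /= /eval_origin map_polyC /= meval0_lform polyC0 add0r.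
by rewrite -map_poly_comp map_poly_id // => c _ /=; rewrite mevalC.
Qed.

Definition coef_row (r : 'rV[{poly S}]_n) m : 'rV[S]_n := \row_i (r 0 i)`_m.

(** The forms of [F] vanish at the generic point of the flat, so translation fixes them.
    Divisibility by such a form can then be read off from each power of [t] separately. *)
Lemma logder_coef_translate m theta :
  logder f F theta -> logder f F (coef_row (map_mx translate theta) m).
Proof.
move=> Dth e eF; have [q Eq] := Dth e eF; exists (translate q)`_m.
have -> : pairing (coef_row (map_mx translate theta) m) (f e) =
    (translate (pairing theta (f e)))`_m.
  rewrite /pairing rmorph_sum coef_sum; apply: eq_bigr => i _.
  by rewrite /= translateZ coefCM mul_mpolyC !mxE.
by rewrite Eq rmorphM /= translate_lform_in ?mem_span_of // coefCM.
Qed.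

Lemma polyrow_sum (r : 'rV[{poly S}]_n) :
  exists N, r = \sum_(m < N) 'X^m *: map_mx polyC (coef_row r m).
Proof.
exists (\max_i size (r 0%R i)); apply/rowP => i; rewrite summxE.
transitivity (\poly_(m < \max_i size (r 0%R i)) (r 0 i)`_m).
  apply/polyP => j; rewrite coef_poly; case: ltnP => // le.
  by rewrite nth_default // (leq_trans _ le) // (leq_bigmax i).
by rewrite poly_def; apply: eq_bigr => m _; rewrite !mxE -mul_polyC mulrC.
Qed.

Definition homogeneous_logder theta :=
  logder f F theta /\ exists d, forall i, theta 0 i \is d.-homog.

Definition const_row (r : 'rV[{poly S}]_n) :=
  exists2 theta, homogeneous_logder theta & r = map_mx polyC theta.

Lemma lspan_logder c theta :
  logder f F theta -> lspan const_row (c *: map_mx polyC theta).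
Proof.
move=> Dth; pose N := \max_i mmeasure mdeg (theta 0%R i).
have -> : theta = \sum_(d < N) map_mx (pihomog mdeg d) theta.
  apply/rowP => i; rewrite summxE.
  rewrite [LHS](pihomog_partitionE (mf := mdeg) (k := N)) ?(leq_bigmax i) //.
  by apply: eq_bigr => d _; rewrite mxE.
rewrite (raddf_sum (map_mx polyC)) scaler_sumr.
apply: lspan_sum => d _; apply: lspan_mem; exists (map_mx (pihomog mdeg d) theta) => //.
split; first exact: logder_pihomog.
by exists d => i; rewrite mxE pihomogP.
Qed.

(** The translate is expanded in powers of [t] and each coefficient in homogeneous components; all
    the pieces remain logarithmic along [F]. *)
Lemma lspan_translate theta :
  logder f F theta -> lspan const_row (map_mx translate theta).
Proof.
move=> Dth; have [N ->] := polyrow_sum (map_mx translate theta).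
by apply: lspan_sum => m _; apply/lspan_logder/logder_coef_translate.
Qed.

Lemma defpoly_fsetD : defpoly f A = defpoly f F * defpoly f (A `\` F)%fset.
Proof.
rewrite /defpoly -big_cat; apply: perm_big; apply: uniq_perm.
- exact: fset_uniq.
- rewrite cat_uniq !fset_uniq andbT /=; apply/hasPn => e.
  by rewrite inE => /andP[].
move=> e; rewrite mem_cat inE; case: (boolP (e \in F)) => //= eF.
exact: (fsubsetP FA).
Qed.

Lemma homogeneous_basis : exists2 N : 'M[S]_n,
  forall i, homogeneous_logder (row i N) &
  exists2 h, \det N = defpoly f F * h & h.@[fun=> 0] != 0.
Proof.
have sFA : {subset F <= A} by apply/fsubsetP.
have QF0 : defpoly f F != 0 by apply: (defpoly_neq0 simA).
have [M [M' [DM gen MM']]] := free_matrix_basis simA freeA.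
have [g [g' [dM gg']]] := det_basis simA DM gen MM'.
(* If no such [N] existed, determinants of homogeneous rows of [D(F)] would
   all lie in the ideal [J], hence so would the determinant of a basis of
   [D(A)] translated to the generic point of the flat, whose cofactor of
   [defpoly f F] does not vanish at the origin. *)
pose J (P : {poly S}) := forall m, exists2 h, P`_m = defpoly f F * h & h.@[fun=> 0] = 0.
have J0 : J 0 by move=> m; exists 0; rewrite ?coef0 ?mulr0 ?meval0.
have JD P P' : J P -> J P' -> J (P + P').
  move=> JP JP' m; have [h Eh h0] := JP m; have [h' Eh' h'0] := JP' m.
  by exists (h + h'); rewrite ?coefD ?Eh ?Eh' ?mulrDr // mevalD h0 h'0 addr0.
have JM P P' : J P' -> J (P * P').
  move=> JP m; rewrite coefM; elim/big_ind: _ => [|a b [h -> h0] [h' -> h'0]|i _].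
  - by exists 0; rewrite ?mulr0 ?meval0.
  - by exists (h + h'); rewrite ?mulrDr // mevalD h0 h'0 addr0.
  - have [h Eh h0] := JP (m - i)%N; exists (P`_i * h); first by rewrite Eh mulrCA.
    by rewrite mevalM h0 mulr0.
apply: NNPP => noN.
have Jconst (N : 'M[{poly S}]_n) : (forall i, const_row (row i N)) -> J (\det N).
  move=> /fin_all_exists2[r Dr Er].
  pose N' := \matrix_i r i.
  have -> : N = map_mx polyC N'.
    by apply/row_matrixP => i; rewrite Er -map_row rowK.
  have DN' i : homogeneous_logder (row i N') by rewrite rowK.
  have [h Eh] := det_logder simA FA (fun i => (DN' i).1).
  rewrite det_map_mx Eh => m; rewrite coefC; case: eqP => _; last first.
    by exists 0; rewrite ?mulr0 ?meval0.
  exists h => //; apply/eqP/negPn/negP => h0; case: noN.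
  by exists N' => //; exists h.
have: J (\det (map_mx translate M)).
  apply: (det_lspan J0 JD JM Jconst) => i; rewrite -map_row.
  apply: lspan_translate; exact: logder_sub (DM i).
rewrite det_map_mx dM defpoly_fsetD -mulrA rmorphM /=.
have -> : translate (defpoly f F) = (defpoly f F)%:P.
  rewrite /defpoly !rmorph_prod; apply: eq_big_seq => e eF.
  by rewrite /= translate_lform_in ?mem_span_of.
set P := translate _ => JP.
have: eval_origin P = 0.
  apply/polyP => m; rewrite coef_map coef0 /=.
  by have [h] := JP m; rewrite coefCM => /(mulfI QF0)->.
(* The hyperplanes outside [F] avoid the generic point and [g] is a unit, so [P] cannot vanish
   there. *)
apply/eqP; rewrite /P !rmorphM mulf_neq0 //.
  rewrite /defpoly !rmorph_prod prodf_seq_neq0; apply/allP => e; rewrite inE => /andP[eF eA] /=.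
  by rewrite eval_origin_lform generic_value_eq0; apply: contra eF; apply: clF.
apply/eqP => Eg; have /eqP[] := oner_neq0 {poly K}.
transitivity (eval_origin (translate (g * g'))).
  by rewrite gg' (rmorph1 translate) (rmorph1 eval_origin).
by rewrite (rmorphM translate) (rmorphM eval_origin) [X in X * _]Eg mul0r.
Qed.

(** Homogeneous rows make [\det N] homogeneous. Its component of degree [size F] is [defpoly f F]
    times the nonzero constant term of [h], so it is the whole determinant and Saito's criterion
    applies. *)
Theorem free_localization : free_submodule (logder f F).
Proof.
have [N DN [h dN h0]] := homogeneous_basis.
have QF0 : defpoly f F != 0 by apply: (defpoly_neq0 simA); apply/fsubsetP.
have [d Hd] := fin_all_exists (fun i => (DN i).2).
have hN : \det N \is (\sum_i d i).-homog.
  by apply: dhomog_det => i j; have := Hd i j; rewrite mxE.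
have Ep : pihomog mdeg (size F) (\det N) = defpoly f F * (h.@[fun=> 0])%:MP.
  by rewrite dN -[size F]addn0 (pihomogM _ _ (dhomog_defpoly _ _)) pihomog0_const.
apply: (saito simA (N := N) (c := h.@[fun=> 0])) => // [i|]; first exact: (DN i).1.
rewrite -Ep; have [Ed|ne] := eqVneq (\sum_i d i)%N (size F).
  by rewrite pihomog_dE // -Ed.
have := Ep; rewrite (pihomog_ne0 ne hN) => /esym/eqP.
by rewrite mulf_eq0 (negbTE QF0) mpolyC_eq0 (negbTE h0).
Qed.

End Localization.

(** * Matroids *)

Section RepresentedMatroids.
Variables (K : fieldType) (n : nat) (T : choiceType).
Variables (M : matroid T) (g : T -> 'rV[K]_n).
Local Notation A := (ground M).
Implicit Types (e : T) (X Y Z : {fset T}).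
Local Open Scope fset_scope.

(** Used for two representations of one matroid: by the forms of the arrangement, and over the
    two-element field. *)
Definition represents := forall X, X `<=` A -> rk M X = \dim (span_of g X).

Hypothesis repM : represents.

Lemma span_of_sub X Y : X `<=` Y -> (span_of g X <= span_of g Y)%VS.
Proof.
move=> /fsubsetP sXY; apply: sub_span => v /mapP[e eX ->].
exact/map_f/sXY.
Qed.

Lemma span_ofU X Y : span_of g (X `|` Y) = (span_of g X + span_of g Y)%VS.
Proof.
rewrite /span_of -span_cat -map_cat; apply: eq_span => v.
by apply/mapP/mapP => -[e eX ->]; exists e => //; move: eX; rewrite inE mem_cat.
Qed.

Lemma span_of1 e : span_of g [fset e] = <[g e]>%VS.
Proof.
rewrite /span_of -span_seq1; apply: eq_span => v; rewrite inE.
apply/mapP/eqP => [[x]|->]; first by rewrite inE => /eqP-> ->.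
by exists e; rewrite ?inE.
Qed.

Lemma mem_cl X e : X `<=` A -> (e \in cl M X) = (e \in A) && (g e \in span_of g X).
Proof.
move=> sXA; rewrite !inE /=; case: (boolP (e \in A)) => //= eA.
rewrite !repM //; last by rewrite fsubUset fsub1set eA.
rewrite span_ofU span_of1 memvE eq_sym dimv_leqif_sup ?addvSr //.
by rewrite subv_add subvv andbT.
Qed.

Lemma flat_closed X : flat M X <-> X `<=` A /\ closed_in A g X.
Proof.
split=> [[sXA clX]|[sXA clX]]; split=> //.
  by move=> e eA eX; rewrite -clX mem_cl // eA.
apply/fsetP => e; rewrite mem_cl //; apply/andP/idP => [[eA]|eX]; first exact: clX.
by split; [apply: (fsubsetP sXA) | apply: mem_span_of].
Qed.

Lemma span_of_cl X : X `<=` A -> span_of g (cl M X) = span_of g X.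
Proof.
move=> sXA; apply/eqP; rewrite eqEsubv; apply/andP; split.
  by apply/span_subvP => v /mapP[e]; rewrite mem_cl // => /andP[_ ?] ->.
apply/span_of_sub/fsubsetP => e eX.
by rewrite mem_cl // (fsubsetP sXA) ?mem_span_of.
Qed.

Lemma cl_sub X : cl M X `<=` A.
Proof. by apply/fsubsetP => e; rewrite !inE => /andP[]. Qed.

Lemma sub_cl X : X `<=` A -> X `<=` cl M X.
Proof.
by move=> sXA; apply/fsubsetP => e eX; rewrite mem_cl // (fsubsetP sXA) ?mem_span_of.
Qed.

Lemma flat_cl X : X `<=` A -> flat M (cl M X).
Proof.
move=> sXA; apply/flat_closed; split; first exact: cl_sub.
by move=> e eA; rewrite span_of_cl // mem_cl // eA.
Qed.

Lemma rk_cl X : X `<=` A -> rk M (cl M X) = rk M X.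
Proof. by move=> sXA; rewrite !repM ?cl_sub // span_of_cl. Qed.

(** The dimension formula for a sum of two subspaces. *)
Lemma modular_pair_span_cap X Y : flat M X -> flat M Y ->
  (span_of g X :&: span_of g Y = span_of g (X `&` Y))%VS -> modular_pair M X Y.
Proof.
move=> fX fY cap; have [[sX _] [sY _]] := (fX, fY); split=> //.
rewrite rk_cl ?fsubUset ?sX // !repM ?fsubUset ?sX //; last first.
  exact: fsubset_trans (fsubsetIl _ _) sX.
by rewrite -cap span_ofU [RHS]addnC dimv_sum_cap.
Qed.

Lemma represents_restr X : forall Y, Y `<=` ground (restr M X) ->
  rk (restr M X) Y = \dim (span_of g Y).
Proof. by move=> Y sY; apply: repM; apply: fsubset_trans sY (fsubsetIr _ _). Qed.

(** Simplicity in terms of ranks alone, so that it passes from one representation to another. *)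
Definition simple_matroid :=
  {in A, forall e, rk M [fset e] = 1%N} /\
  {in A &, forall e e', e != e' -> rk M [fset e; e'] = 2%N}.

Lemma simple_family_rk : simple_family A g <-> simple_matroid.
Proof.
have sub1 e : e \in A -> [fset e] `<=` A by rewrite fsub1set.
have sub2 e e' : e \in A -> e' \in A -> [fset e; e'] `<=` A.
  by move=> eA e'A; rewrite fsubUset !sub1.
have rk1 e : e \in A -> rk M [fset e] = (g e != 0).
  by move=> eA; rewrite repM ?sub1 // span_of1 dim_vline.
have rk2 e e' : e \in A -> e' \in A -> g e' != 0 ->
    (rk M [fset e; e'] == 2%N) = (g e \notin <[g e']>%VS).
  move=> eA e'A nz; rewrite repM ?sub2 // span_ofU !span_of1.
  have := dimv_leqif_sup (addvSr <[g e]> <[g e']>); rewrite subv_add subvv andbT -memvE.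
  rewrite dim_vline nz => -[le1 <-].
  have: (\dim (<[g e]> + <[g e']>) <= 2)%N.
    apply: leq_trans (dimv_add_leqif _ _) _.
    by rewrite !dim_vline; case: (g e != 0); case: (g e' != 0).
  by move: le1; case: (\dim _) => [|[|[|]]].
split=> [[s1 s2]|[s1 s2]]; split=> [e eA|e e' eA e'A ne].
- by rewrite rk1 // s1.
- by apply/eqP; rewrite rk2 ?s1 // s2.
- by apply: contraTneq isT => g0; have := s1 _ eA; rewrite rk1 // g0 eqxx.
- rewrite -rk2 ?s2 //; apply: contraTneq isT => g0.
  by have := s1 _ e'A; rewrite rk1 // g0 eqxx.
Qed.

End RepresentedMatroids.

(** * Small separations *)

Section Connectivity.
Variables (T : choiceType) (M : matroid T).
Local Notation A := (ground M).
Implicit Types (F G : {fset T}).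
Local Open Scope fset_scope.

(* Splitting off [G `\ a] from the rest of the matroid gives a separation of
   order at most two. *)
Lemma no_split F F' G G' a b x : simple_matroid M -> n_connected M 3 ->
    F `|` F' = A -> F `&` F' = [fset a; b] -> G `|` G' = F -> G `&` G' = fset0 ->
    a \in G -> b \in G' -> x \in G -> x != a -> (2 <= #|` F'|)%N ->
    (rk M F + rk M F' = 2 + rk M A)%N -> (rk M G + rk M G' <= rk M F)%N -> False.
Proof.
move=> [rk1 rk2] conn FA Fab GF dis aG bG' xG xa cF' rkA rkF.
have inF e : (e \in G) || (e \in G') = (e \in F) by rewrite -GF inE.
have inA e : (e \in F) || (e \in F') = (e \in A) by rewrite -FA inE.
have inT e : (e \in F) && (e \in F') = (e == a) || (e == b) by rewrite -in_fsetI Fab !inE.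
have ndis e : e \in G -> e \in G' -> False.
  by move=> eG eG'; have := in_fset0 e; rewrite -dis inE eG eG'.
pose Y := G `\ a.
have sF'A : F' `<=` A by apply/fsubsetP => e eF; rewrite -inA eF orbT.
have sG'A : G' `<=` A by apply/fsubsetP => e eG; rewrite -inA -inF eG orbT.
have sGA : G `<=` A by apply/fsubsetP => e eG; rewrite -inA -inF eG.
have sYG : Y `<=` G by apply: fsubD1set.
have AY : A `\` Y = F' `|` G'.
  apply/fsetP => e; rewrite !inE -inA -inF; have := inT e; rewrite -inF.
  case: (boolP (e \in G)) => eG /=; rewrite ?andbF ?andbT /=; last first.
    by case: (e \in F'); case: (e \in G').
  have -> : (e \in G') = false by apply/negP => /(ndis _ eG).
  rewrite orbF; case: (eqVneq e a) => [->|_] /=; first by move->.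
  move=> ->; case: eqVneq => // eb; case: (ndis b) => //; by rewrite -eb.
(* Both [F'] and [G'] contain [b], so submodularity gains one over the sum of their ranks. *)
have rkAY : (rk M (A `\` Y) + rk M G + 1 <= rk M A + 2)%N.
  have := rk_submod sF'A sG'A; rewrite AY.
  have: (1 <= rk M (F' `&` G'))%N.
    have bF' : b \in F' by have := inT b; rewrite eqxx orbT => /andP[].
    have bA : b \in A by apply: (fsubsetP sF'A).
    rewrite -(rk1 b bA); apply: rk_mono; last exact: fsubset_trans (fsubsetIl _ _) sF'A.
    by rewrite fsub1set inE bF'.
  by lia.
have cAY : (2 <= #|` A `\` Y|)%N.
  by rewrite AY; apply: leq_trans cF' (fsubset_leq_card (fsubsetUl _ _)).
have sYA : Y `<=` A := fsubset_trans sYG sGA.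
have YA : Y `|` (A `\` Y) = A.
  apply/fsetP => e; rewrite in_fsetU in_fsetD.
  by case: (boolP (e \in Y)) => //= eY; rewrite (fsubsetP sYA).
have YD : Y `&` (A `\` Y) = fset0.
  by apply/fsetP => e; rewrite in_fsetI in_fsetD in_fset0; case: (e \in Y).
have rkY : (rk M Y <= rk M G)%N by apply: rk_mono.
have cY : (0 < #|` Y|)%N by rewrite cardfs_gt0; apply/fset0Pn; exists x; rewrite !inE xa.
(* With two or more elements [Y] gives a 2-separation. If [Y] is a single point, its rank is at most
   one whereas [G] has rank at least two; this lowers the connectivity to zero and gives a
   1-separation. *)
have [cY2|cY1] := leqP 2 #|` Y|.
  by apply: (conn 2 Y (A `\` Y)) => //; split=> //; rewrite /lambda; lia.
apply: (conn 1%N Y (A `\` Y)) => //; split=> //; first by lia.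
have: (rk M Y <= 1)%N by apply: leq_trans (rk_card sYA) _.
have: (2 <= rk M G)%N.
  have aA := fsubsetP sGA _ aG; have xA := fsubsetP sGA _ xG.
  rewrite -(rk2 x a) //; apply: rk_mono => //.
  by rewrite fsubUset !fsub1set xG.
by rewrite /lambda /=; lia.
Qed.

End Connectivity.

(** * Lines over the two-element field *)

Section BinaryLines.
Variables (n : nat) (T : choiceType) (M : matroid T) (g : T -> 'rV['F_2]_n).
Local Notation A := (ground M).
Implicit Types (X Y Z F : {fset T}).
Local Open Scope fset_scope.
Hypotheses (repM : represents M g) (simM : simple_matroid M).

Lemma F2_cases (k : 'F_2) : k = 0 \/ k = 1.
Proof. by case: k => [[|[|k]]] // lt; [left | right]; apply: val_inj. Qed.

(** A plane over the two-element field has only the nonzero vectors [g a], [g b] and [g a + g b], so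
    three distinct points exhaust it. *)
Lemma binary_line_span X : X `<=` A -> rk M X = 2%N -> (3 <= #|` X|)%N ->
  #|` X| = 3%N /\ forall v, v \in span_of g X -> v = 0 \/ exists2 e, e \in X & v = g e.
Proof.
move=> sXA rkX cX; have sim : simple_family A g by apply/(simple_family_rk repM).
have inA e : e \in X -> e \in A := fsubsetP sXA e.
have [a aX] : exists a, a \in X by apply/fset0Pn; rewrite -cardfs_gt0; lia.
have cXa : #|` X `\ a| = #|` X|.-1 by rewrite (cardfsD1 a X) aX.
have [b] : exists b, b \in X `\ a by apply/fset0Pn; rewrite -cardfs_gt0; lia.
rewrite !inE => /andP[ba bX].
have cXab : #|` (X `\ a) `\ b| = #|` X|.-2.
  by have := cardfsD1 b (X `\ a); rewrite !inE ba bX; lia.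
have [c] : exists c, c \in (X `\ a) `\ b by apply/fset0Pn; rewrite -cardfs_gt0; lia.
rewrite !inE => /and3P[cb ca cX'].
have Eab : span_of g X = (<[g a]> + <[g b]>)%VS.
  rewrite -!(span_of1 g) -span_ofU; apply/esym/eqP; rewrite eqEdim.
  have sab : [fset a; b] `<=` X by rewrite fsubUset !fsub1set aX.
  rewrite span_of_sub //= -!repM // ?rkX ?(fsubset_trans sab) //.
  by rewrite simM.2 ?inA // eq_sym.
have spanP v : v \in span_of g X -> [\/ v = 0, v = g a, v = g b | v = (g a + g b)%R].
  rewrite Eab => /memv_addP[_ /vlineP[k ->] [_ /vlineP[l ->] ->]].
  case: (F2_cases k) => ->; case: (F2_cases l) => ->; rewrite ?scale0r ?scale1r ?add0r ?addr0.
  - by apply: Or41.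
  - by apply: Or43.
  - by apply: Or42.
  - by apply: Or44.
have g_inj e e' : e \in X -> e' \in X -> g e = g e' -> e = e'.
  move=> eX e'X E; apply/eqP/negPn/negP => ne.
  by have := sim.2 _ _ (inA _ eX) (inA _ e'X) ne; rewrite E memv_line.
have third e : e \in X -> e != a -> e != b -> g e = (g a + g b)%R.
  move=> eX ea eb; have [ge|ge|ge|//] := spanP _ (mem_span_of g eX).
  - by have := sim.1 _ (inA _ eX); rewrite ge eqxx.
  - by move: ea; rewrite (g_inj _ _ eX aX ge) eqxx.
  - by move: eb; rewrite (g_inj _ _ eX bX ge) eqxx.
have gc := third c cX' ca cb.
split.
  have -> : X = a |` (b |` [fset c]).
    apply/fsetP => e; rewrite !inE; apply/idP/or3P => [eX|[]/eqP-> //].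
    have [ea|ea] := eqVneq e a; first exact: Or31.
    have [eb|eb] := eqVneq e b; first exact: Or32.
    by apply: Or33; apply/eqP/(g_inj _ _ eX cX'); rewrite gc; apply: third.
  by rewrite !cardfsU1 cardfs1 !inE ![_ == c]eq_sym eq_sym !negb_or ba ca cb.
move=> v /spanP[->|->|->|->]; first by left.
- by right; exists a.
- by right; exists b.
- by right; exists c.
Qed.

Variable L : {fset T}.
Hypothesis lineL : three_point_line M L.

(** Every nonzero vector in the span of [L] is a point of [L]; if it also lies in the span of the
    flat [Y], that point belongs to [Y]. *)
Lemma binary_line_cap Y : flat M Y ->
  (span_of g L :&: span_of g Y = span_of g (L `&` Y))%VS.
Proof.
case: lineL => [[sLA _] rkL cL] /(flat_closed repM)[sYA clY].
have [|_ spL] := binary_line_span sLA rkL; first by rewrite cL.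
apply/eqP; rewrite eqEsubv subv_cap !span_of_sub ?fsubsetIl ?fsubsetIr //= andbT.
apply/subvP => v; rewrite memv_cap => /andP[/spL[->|[e eL ->]] eY]; first exact: mem0v.
by rewrite mem_span_of // inE eL clY // (fsubsetP sLA).
Qed.

Lemma binary_line_modular : modular_flat M L.
Proof.
case: lineL => fL _ _; split=> // Y fY.
exact: (modular_pair_span_cap repM fL fY (binary_line_cap fY)).
Qed.

End BinaryLines.

(** * Modular pairs and 3-separations in matroids of free arrangements *)

Section FreeMatroids.
Variables (K : fieldType) (n : nat) (T : choiceType).
Variables (M : matroid T) (f : T -> 'rV[K]_n).
Local Notation A := (ground M).
Implicit Types (F X Y Z : {fset T}).
Local Open Scope fset_scope.
Hypotheses (repM : represents M f) (simf : simple_family A f).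
Hypothesis freeA : free_submodule (logder f A).

Let simM : simple_matroid M := (simple_family_rk repM).1 simf.

Lemma free_modular_pair F1 F2 :
  flat M F1 -> flat M F2 -> F1 `|` F2 = A -> modular_pair M F1 F2.
Proof.
move=> fl1 fl2 FA; apply: (modular_pair_span_cap repM fl1 fl2).
have [_ cl1] := (flat_closed repM F1).1 fl1.
have [_ cl2] := (flat_closed repM F2).1 fl2.
exact: (span_cap simf freeA FA cl1 cl2).
Qed.

(** Different eigenvalues at [a] and [b] would split [F] into a direct sum separating them. A third
    point [x] of [F] lies on one of the two sides, and [no_split] is applied to that side, with [a]
    and [b] exchanged if necessary. *)
Lemma connected_eigenvalues F F' a b (L : 'M[K]_n) k l : n_connected M 3 ->
    F `|` F' = A -> F `&` F' = [fset a; b] -> (3 <= #|` F|)%N -> (2 <= #|` F'|)%N ->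
    (rk M F + rk M F' = 2 + rk M A)%N ->
    {in F, forall e, exists c, (f e *m L = c *: f e)%R} ->
    f a *m L = (k *: f a)%R -> f b *m L = (l *: f b)%R -> k = l.
Proof.
move=> conn FA Fab cF cF' rkA FL aL bL; apply/eqP/negPn/negP => kl.
have [aF bF] : a \in F /\ b \in F.
  have: [fset a; b] `<=` F by rewrite -Fab fsubsetIl.
  by rewrite fsubUset !fsub1set => /andP.
have sFA : F `<=` A by rewrite -FA fsubsetUl.
pose G := [fset e in F | f e *m L == k *: f e]%R.
have sGF : G `<=` F by apply/fsubsetP => e; rewrite !inE => /andP[].
have cap0 := eigen_split (f := f) (F := F) k FL; rewrite -/G in cap0.
have GG' : G `|` (F `\` G) = F.
  apply/fsetP => e; rewrite in_fsetU in_fsetD.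
  by case: (boolP (e \in G)) => //= eG; rewrite (fsubsetP sGF).
have dis : G `&` (F `\` G) = fset0.
  by apply/fsetP => e; rewrite in_fsetI in_fsetD in_fset0; case: (e \in G).
have rkG : (rk M G + rk M (F `\` G) <= rk M F)%N.
  rewrite !repM ?(fsubset_trans _ sFA) ?fsubsetDl // -(dimv_disjoint_sum cap0).
  by rewrite -span_ofU GG'.
have aG : a \in G by rewrite !inE aF aL eqxx.
have bG : b \in F `\` G.
  rewrite !inE bF andbT bL /= -subr_eq0 -scalerBl scaler_eq0 subr_eq0 eq_sym.
  by rewrite (negbTE kl) /= simf.1 // (fsubsetP sFA).
have [x] : exists x, x \in (F `\ a) `\ b.
  apply/fset0Pn; rewrite -cardfs_gt0.
  have := cardfsD1 b (F `\ a); have := cardfsD1 a F; rewrite aF.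
  by case: (b \in _); lia.
rewrite !in_fsetD1 => /and3P[xb xa xF].
have [xG|xG] := boolP (x \in G).
  exact: (no_split simM conn FA Fab GG' dis aG bG xG xa cF' rkA rkG).
apply: (no_split simM conn FA _ _ _ bG aG (x := x) _ xb cF' rkA) => //.
- by rewrite Fab; apply/fsetP => e; rewrite !inE orbC.
- by rewrite fsetUC.
- by rewrite fsetIC.
- by rewrite in_fsetD xG.
- by rewrite addnC.
Qed.

(** On each flat the eigenvalues at [a] and [b] agree, so [L1 + L2] multiplies [f a] and [f b] by
    the same scalar; but it fixes [f a] and kills [f b]. *)
Lemma two_point_contradiction F1 F2 a b : n_connected M 3 ->
  flat M F1 -> flat M F2 -> F1 `|` F2 = A -> F1 `&` F2 = [fset a; b] -> a != b ->
  (3 <= #|` F1|)%N -> (3 <= #|` F2|)%N -> (rk M F1 + rk M F2 = 2 + rk M A)%N -> False.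
Proof.
move=> conn fl1 fl2 FA Fab ab c1 c2 rkA.
have [_ cl1] := (flat_closed repM F1).1 fl1.
have [_ cl2] := (flat_closed repM F2).1 fl2.
have [L1 [L2 [E1 E2 La Lb]]] := two_point_intersection simf freeA FA cl1 cl2 Fab ab.
have [aA bA] : a \in A /\ b \in A.
  have: [fset a; b] `<=` A by rewrite -Fab (fsubset_trans (fsubsetIl _ _)) // -FA fsubsetUl.
  by rewrite fsubUset !fsub1set => /andP.
have [[a1 a2] [b1 b2]] : (a \in F1 /\ a \in F2) /\ (b \in F1 /\ b \in F2).
  have: a \in F1 `&` F2 /\ b \in F1 `&` F2 by rewrite Fab !inE !eqxx orbT.
  by rewrite !inE => -[/andP ? /andP ?].
have [k1 Ea1] := E1 a a1; have [k2 Ea2] := E2 a a2.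
have [l1 Eb1] := E1 b b1; have [l2 Eb2] := E2 b b2.
have kl1 : k1 = l1.
  exact: (connected_eigenvalues conn FA Fab c1 (ltnW c2) rkA E1 Ea1 Eb1).
have kl2 : k2 = l2.
  apply: (connected_eigenvalues conn _ _ c2 (ltnW c1) _ E2 Ea2 Eb2).
  - by rewrite fsetUC.
  - by rewrite fsetIC.
  - by rewrite addnC.
move: La Lb; rewrite !mulmxDr Ea1 Ea2 Eb1 Eb2 -!scalerDl kl1 kl2 => /eqP.
rewrite -[X in _ == X]scale1r -subr_eq0 -scalerBl scaler_eq0 (negbTE (simf.1 a aA)) orbF.
rewrite subr_eq0 => /eqP-> /eqP; rewrite scale1r; apply/negP; exact: simf.1.
Qed.

(** Closures keep ranks, so exactness and modularity of the pair of closures give rank two. Rank two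
    needs at least two points, and exactly two are excluded by [two_point_contradiction]. *)
Lemma free_separation_line Y1 Y2 : n_connected M 3 -> exact_separation M 3 Y1 Y2 ->
    (4 <= #|` Y1|)%N -> (4 <= #|` Y2|)%N ->
  [/\ cl M Y1 `|` cl M Y2 = A, rk M (cl M Y1 `&` cl M Y2) = 2%N &
    (3 <= #|` cl M Y1 `&` cl M Y2|)%N].
Proof.
move=> conn [[_ [YA YD] _ _ _] lamY] c1 c2.
have sY1 : Y1 `<=` A by rewrite -YA fsubsetUl.
have sY2 : Y2 `<=` A by rewrite -YA fsubsetUr.
have AY : A `\` Y1 = Y2.
  apply/fsetP => e; rewrite -YA !inE; have := in_fset0 e; rewrite -YD inE.
  by case: (e \in Y1); case: (e \in Y2).
set F1 := cl M Y1; set F2 := cl M Y2.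
have sYF1 : Y1 `<=` F1 by apply: (sub_cl repM).
have sYF2 : Y2 `<=` F2 by apply: (sub_cl repM).
have fl1 : flat M F1 by apply: (flat_cl repM).
have fl2 : flat M F2 by apply: (flat_cl repM).
have [sF1 _] := fl1; have [sF2 _] := fl2.
have FA : F1 `|` F2 = A.
  by apply/eqP; rewrite eqEfsubset fsubUset sF1 sF2 -YA fsetUSS.
have [_ _ rkF] := free_modular_pair fl1 fl2 FA.
have rkFA : rk M (cl M (F1 `|` F2)) = rk M A by rewrite (rk_cl repM) FA.
have rkT : rk M (F1 `&` F2) = 2%N.
  move: lamY rkF; rewrite rkFA /lambda AY /F1 /F2 !(rk_cl repM) //=.
  by lia.
split=> //; rewrite ltnNge; apply/negP => cT.
have cT2 : #|` F1 `&` F2| = 2%N.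
  apply/eqP; rewrite eqn_leq cT -rkT rk_card //.
  exact: fsubset_trans (fsubsetIl _ _) sF1.
have [a aT] : exists a, a \in F1 `&` F2 by apply/fset0Pn; rewrite -cardfs_gt0 cT2.
have [b] : exists b, b \in (F1 `&` F2) `\ a.
  by apply/fset0Pn; rewrite -cardfs_gt0; have := cardfsD1 a (F1 `&` F2); rewrite aT; lia.
rewrite in_fsetD1 => /andP[ba bT].
have Tab : F1 `&` F2 = [fset a; b].
  apply/esym/eqP; rewrite eqEfcard fsubUset !fsub1set aT bT /=.
  by rewrite cT2 cardfs2 eq_sym ba.
apply: (two_point_contradiction conn fl1 fl2 FA Tab); rewrite 1?eq_sym //.
- exact: leq_trans (ltnW c1) (fsubset_leq_card sYF1).
- exact: leq_trans (ltnW c2) (fsubset_leq_card sYF2).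
- by rewrite rkF rkT rkFA.
Qed.

End FreeMatroids.

(** * The modular join along a binary line *)

Section BinaryJoin.
Variables (n : nat) (T : choiceType) (M : matroid T) (g : T -> 'rV['F_2]_n).
Local Notation A := (ground M).
Implicit Types (X Y Z : {fset T}).
Local Open Scope fset_scope.
Hypotheses (repM : represents M g) (simM : simple_matroid M).
Variables F1 F2 : {fset T}.
Hypotheses (fl1 : flat M F1) (fl2 : flat M F2) (FA : F1 `|` F2 = A).
Hypothesis capF : (span_of g F1 :&: span_of g F2 = span_of g (F1 `&` F2))%VS.
Hypothesis lineT : three_point_line M (F1 `&` F2).

Lemma simple_restr X : simple_matroid (restr M X).
Proof.
have sXA : ground (restr M X) `<=` A by apply: fsubsetIr.
by split=> [e eX|e e' eX e'X ne]; [apply: simM.1 | apply: simM.2]; rewrite ?(fsubsetP sXA).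
Qed.

Lemma flat_restr_closed X Y : X `<=` A ->
  flat (restr M X) Y <-> Y `<=` X /\ {in X, forall e, g e \in span_of g Y -> e \in Y}.
Proof.
move=> sXA; rewrite (flat_closed (represents_restr repM (X := X))) /=.
by rewrite (fsetIidPl sXA).
Qed.

Lemma three_point_line_restr X : X `<=` A -> F1 `&` F2 `<=` X ->
  three_point_line (restr M X) (F1 `&` F2).
Proof.
move=> sXA sTX; case: lineT => fT rkT cT; split=> //.
have [sTA clT] := (flat_closed repM _).1 fT.
apply/(flat_restr_closed _ sXA); split=> // e eX.
exact: clT (fsubsetP sXA _ eX).
Qed.

Lemma line_modular_restr X : X `<=` A -> F1 `&` F2 `<=` X ->
  modular_flat (restr M X) (F1 `&` F2).
Proof.
move=> sXA sTX; apply: (binary_line_modular (represents_restr repM (X := X))).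
  exact: simple_restr.
exact: three_point_line_restr.
Qed.

(** Write [g e] as [u + v] with [u] from the part of [Z] in [F] and [v] from the part in [F']. Then
    [v] lies in both spans, hence in that of the line, so it is zero or a point of the line. In the
    latter case flatness of the part in [F'] puts this point into [Z], on the side of [F] as
    well. *)
Lemma join_closed Z F F' : F `<=` A -> F' `<=` A -> F `&` F' = F1 `&` F2 ->
    (span_of g F :&: span_of g F' = span_of g (F `&` F'))%VS ->
    flat (restr M F) (Z `&` F) -> flat (restr M F') (Z `&` F') -> Z `<=` F `|` F' ->
  {in F, forall e, g e \in span_of g Z -> e \in Z}.
Proof.
move=> sF sF' ET cap /(flat_restr_closed _ sF)[_ cl] /(flat_restr_closed _ sF')[_ cl'] sZ.
move=> e eF; have -> : Z = (Z `&` F) `|` (Z `&` F').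
  by rewrite -fsetIUr; apply/esym/fsetIidPl.
rewrite span_ofU => /memv_addP[u uZ [v vZ Ee]].
suff vZF : v \in span_of g (Z `&` F).
  by rewrite in_fsetU cl // Ee memvD.
have vT : v \in span_of g (F1 `&` F2).
  rewrite -ET -cap memv_cap; apply/andP; split.
    have -> : v = (g e - u)%R by rewrite Ee addrC addKr.
    by rewrite memvB ?mem_span_of // (subvP (span_of_sub g (fsubsetIr Z F))).
  exact: (subvP (span_of_sub g (fsubsetIr Z F'))).
case: lineT => -[sTA _] rkT cT.
have [|_ spT] := binary_line_span repM simM sTA rkT; first by rewrite cT.
have [->|[t tT Ev]] := spT v vT; first exact: mem0v.
have [tF tF'] : t \in F /\ t \in F' by move: tT; rewrite -ET inE => /andP.
rewrite Ev mem_span_of // inE tF andbT.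
by have := cl' t tF'; rewrite -Ev vZ inE => /(_ isT)/andP[].
Qed.

Lemma binary_modular_join :
  is_modular_join M (F1 `&` F2) (restr M F1) (restr M F2).
Proof.
have [sF1 _] := fl1; have [sF2 _] := fl2.
rewrite /is_modular_join /= (fsetIidPl sF1) (fsetIidPl sF2); split=> //.
- split=> //=; rewrite (fsetIidPl sF1) (fsetIidPl sF2).
  by apply/fsetP => e; rewrite !inE; case: (e \in F1); case: (e \in F2).
- by split; apply: line_modular_restr; rewrite ?fsubsetIl ?fsubsetIr.
move=> Z sZ; split=> [/(flat_closed repM)[sZA clZ]|[flZ1 flZ2]].
  split; apply/flat_restr_closed; rewrite ?fsubsetIr //; split; rewrite ?fsubsetIr //.
    move=> e eF eZ; rewrite inE eF andbT clZ ?(fsubsetP sF1) //.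
    exact: (subvP (span_of_sub g (fsubsetIl Z F1))).
  move=> e eF eZ; rewrite inE eF andbT clZ ?(fsubsetP sF2) //.
  exact: (subvP (span_of_sub g (fsubsetIl Z F2))).
apply/(flat_closed repM); split; first by rewrite -FA.
move=> e; rewrite -FA inE => /orP[]; first exact: (join_closed sF1 sF2).
move: e; apply: (join_closed sF2 sF1) => //; first by rewrite fsetIC.
  by rewrite capvC capF fsetIC.
by rewrite fsetUC.
Qed.

End BinaryJoin.

(** * Arrangements in coordinates *)

Section Coordinates.
Variables (K : fieldType) (V : vectType K) (A : {fset {vspace V}}).
Variable alpha : {vspace V} -> 'Hom(V, K^o).
Hypothesis hA : central_arrangement A.
Hypothesis halpha : forall H : {vspace V}, H \in A -> lker (alpha H) = H.
Local Notation n := (\dim {:V}).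

Definition coords (a : 'Hom(V, K^o)) : 'rV[K]_n := \row_i (a (vbasis {:V})`_i : K).

Lemma coords_is_linear : linear coords.
Proof. by move=> c a b; apply/rowP => i; rewrite !mxE !lfunE /= lfunE. Qed.

HB.instance Definition _ := GRing.isLinear.Build K 'Hom(V, K^o) 'rV[K]_n _
  coords coords_is_linear.

Lemma coords_inj : injective coords.
Proof.
move=> a b E; apply/lfunP => v.
rewrite (coord_vbasis (memvf v)) !linear_sum; apply: eq_bigr => i _.
by rewrite !linearZ; congr (_ *: _); move/rowP/(_ i): E; rewrite !mxE.
Qed.

Definition form H := coords (alpha H).

Lemma lin_rk_form X : lin_rk alpha X = \dim (span_of form X).
Proof.
rewrite /lin_rk /span_of (map_comp coords alpha).
have -> : [seq coords a | a <- [seq alpha e | e <- X]] =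
    [seq linfun coords a | a <- [seq alpha e | e <- X]].
  by apply: eq_map => a; rewrite lfunE.
rewrite -limg_span limg_dim_eq //; apply/eqP; rewrite -subv0; apply/subvP => a.
rewrite memv_cap memv_ker memv0 lfunE => /andP[_ /eqP a0].
by apply/eqP/coords_inj; rewrite a0 linear0.
Qed.

Lemma simple_form : simple_family A form.
Proof.
have nz H : H \in A -> form H != 0.
  move=> HA; apply: contraTneq isT => a0.
  have aH : alpha H = 0 by apply: coords_inj; rewrite linear0.
  have := hA HA; rewrite /is_hyperplane -{1}(halpha HA) aH.
  have -> : lker (0 : 'Hom(V, K^o)) = fullv.
    by apply/vspaceP => v; rewrite memv_ker lfunE memvf /= eqxx.
  by move/eqP; rewrite eqn_leq ltnn.
split=> // H H' HA H'A ne; apply/negP => /vlineP[k Ek].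
have k0 : k != 0 by apply: contraTneq (nz _ HA) => k0; rewrite Ek k0 scale0r eqxx.
have aE : alpha H = k *: alpha H' by apply: coords_inj; rewrite linearZ.
case/eqP: ne; rewrite -(halpha HA) -(halpha H'A) aE; apply/vspaceP => v.
by rewrite !memv_ker lfunE /= scaler_eq0 (negbTE k0).
Qed.

Lemma poly_of_form_form H : poly_of_form (alpha H) = lform (form H).
Proof. by apply: eq_bigr => i _; rewrite mxE. Qed.

Lemma apply_der_form theta H :
  apply_der theta (poly_of_form (alpha H)) = pairing theta (form H).
Proof.
rewrite poly_of_form_form; apply: eq_bigr => i _.
by rewrite mderiv_lform mulrC mul_mpolyC.
Qed.

Lemma log_derP X theta : log_der alpha X theta <-> logder form X theta.
Proof.
split=> D H HX; have [q Eq] := D H HX; exists q.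
  by rewrite -apply_der_form Eq poly_of_form_form.
by rewrite apply_der_form Eq poly_of_form_form.
Qed.

Lemma free_arrangementP X :
  free_arrangement alpha X <-> free_submodule (logder form X).
Proof.
by split=> -[B [indB spanB]]; exists B; split=> // theta; split;
  [move=> /log_derP/spanB | move=> /spanB/log_derP
  |move=> /log_derP/spanB | move=> /spanB/log_derP].
Qed.

Lemma represents_form : represents (arr_matroid alpha A) form.
Proof. by move=> X _; apply: lin_rk_form. Qed.

(* A form vanishing on the intersection of the hyperplanes of a flat is a
   combination of their forms. *)
Lemma localization_flat F : flat (arr_matroid alpha A) F ->
  localization A (\bigcap_(H <- F) H)%VS = F.
Proof.
move=> /(flat_closed represents_form)[sFA clF].
apply/fsetP => H; rewrite !inE /=; apply/andP/idP => [[HA sub]|HF]; last first.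
  split; first exact: (fsubsetP sFA).
  by rewrite (big_rem H) //= capvSl.
apply: (clF _ HA); apply/negPn/negP => /notin_dot[u u1 u0].
(* The vector with coordinates [u] lies on all hyperplanes of [F] but not on [H]. *)
pose v := \sum_i u 0 i *: (vbasis {:V})`_i.
have alphav G : alpha G v = dot u (form G).
  rewrite linear_sum dotE; apply: eq_bigr => i _.
  by rewrite linearZ mxE.
have: v \in lker (alpha H).
  rewrite (halpha HA); apply: (subvP sub).
  rewrite big_seq; elim/big_ind: _ => [|U1 U2 v1 v2|G GF]; first exact: memvf.
    by rewrite memv_cap v1.
  by rewrite -(halpha (fsubsetP sFA _ GF)) memv_ker alphav u0 ?mem_span_of.
by rewrite memv_ker alphav u1 oner_eq0.
Qed.

Lemma free_localization_flat F : free_arrangement alpha A ->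
  flat (arr_matroid alpha A) F ->
  exists X : {vspace V}, free_arrangement alpha (localization A X) /\
    eq_matroid (arr_matroid alpha (localization A X)) (restr (arr_matroid alpha A) F).
Proof.
move=> /free_arrangementP freeA flF; exists (\bigcap_(H <- F) H)%VS.
have [sFA clF] := (flat_closed represents_form F).1 flF.
rewrite localization_flat //; split.
  exact/free_arrangementP/(free_localization simple_form freeA sFA clF).
by split=> //=; rewrite (fsetIidPl sFA).
Qed.

End Coordinates.

Local Close Scope ring_scope.
Local Open Scope fset_scope.

Theorem theorem1p3 (K : fieldType) (V : vectType K) (A : {fset {vspace V}})
    (alpha : {vspace V} -> 'Hom(V, K^o))
    (hA : central_arrangement A)
    (halpha : forall H : {vspace V}, H \in A -> lker (alpha H) = H)
    (hfree : free_arrangement alpha A) :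
  let M := arr_matroid alpha A in
  (forall F1 F2 : {fset {vspace V}},
     flat M F1 -> flat M F2 -> F1 `|` F2 = ground M -> modular_pair M F1 F2) /\
  (forall Y1 Y2 : {fset {vspace V}},
     binary M -> n_connected M 3 -> exact_separation M 3 Y1 Y2 ->
     4 <= #|` Y1| -> 4 <= #|` Y2| ->
     let F1 := cl M Y1 in
     let F2 := cl M Y2 in
     let T := F1 `&` F2 in
     [/\ three_point_line M T,
         modular_flat (restr M F1) T /\ modular_flat (restr M F2) T,
         is_modular_join M T (restr M F1) (restr M F2),
         (flat M F1 /\ F1 `<` ground M) /\ (flat M F2 /\ F2 `<` ground M) &
         (exists X : {vspace V}, free_arrangement alpha (localization A X) /\
            eq_matroid (arr_matroid alpha (localization A X)) (restr M F1)) /\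
         (exists X : {vspace V}, free_arrangement alpha (localization A X) /\
            eq_matroid (arr_matroid alpha (localization A X)) (restr M F2))]).
Proof.
move=> M; have freeA := (free_arrangementP alpha A).1 hfree.
have simf := simple_form hA halpha; have repM := represents_form (A := A) (alpha := alpha).
have simM : simple_matroid M := (simple_family_rk repM).1 simf.
split=> [F1 F2 fl1 fl2 FA|Y1 Y2 binM conn sepY c1 c2 F1 F2 L].
  exact: (free_modular_pair repM simf freeA).
have [FA rkL cL] := free_separation_line repM simf freeA conn sepY c1 c2.
rewrite -/F1 -/F2 -/L in FA rkL cL.
have [[_ [YA _] _ _ _] _] := sepY.
have sY1 : Y1 `<=` A by rewrite -[A]/(ground M) -YA fsubsetUl.
have sY2 : Y2 `<=` A by rewrite -[A]/(ground M) -YA fsubsetUr.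
have fl1 : flat M F1 by apply: (flat_cl repM).
have fl2 : flat M F2 by apply: (flat_cl repM).
have [m [g [_ repg]]] := binM.
have {}repg : represents M g by move=> X sX; rewrite repg.
have [sF1 cl1] := (flat_closed repg F1).1 fl1.
have [sF2 cl2] := (flat_closed repg F2).1 fl2.
(* Modularity speaks of ranks only, so it transfers to the binary representation, where the
   dimension formula turns it back into an equality of spans. *)
have capg : (span_of g F1 :&: span_of g F2 = span_of g L)%VS.
  have [_ _] := free_modular_pair repM simf freeA fl1 fl2 FA.
  rewrite (rk_cl repM) FA // -/L => rkE.
  apply/esym/eqP; rewrite eqEdim subv_cap !span_of_sub ?fsubsetIl ?fsubsetIr //=.
  rewrite -(leq_add2l (\dim (span_of g F1 + span_of g F2))) dimv_sum_cap -span_ofU.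
  have sLA : L `<=` A := fsubset_trans (fsubsetIl _ _) sF1.
  by rewrite -!repg ?FA // rkE addnC.
have flL : flat M L.
  apply/(flat_closed repg); split; first exact: fsubset_trans (fsubsetIl _ _) sF1.
  move=> e eA eL; rewrite inE cl1 ?cl2 //.
    exact: (subvP (span_of_sub g (fsubsetIr F1 F2))).
  exact: (subvP (span_of_sub g (fsubsetIl F1 F2))).
have lineL : three_point_line M L.
  by split=> //; have [] := binary_line_span repg simM flL.1 rkL cL.
(* If one of the flats were the whole ground set, [L] would be the other one, which contains at
   least four points. *)
have proper Y : 4 <= #|` Y| -> Y `<=` A -> L = cl M Y -> False.
  move=> cY sYA EL; have [_ _ cL3] := lineL.
  by have := leq_trans cY (fsubset_leq_card (sub_cl repM sYA)); rewrite -EL cL3.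
have properF : F1 `<` A /\ F2 `<` A.
  split; rewrite fproperE ?sF1 ?sF2 /=; apply/negP => sAF.
    by apply: (proper Y2 c2 sY2); apply/fsetIidPr/(fsubset_trans sF2 sAF).
  by apply: (proper Y1 c1 sY1); apply/fsetIidPl/(fsubset_trans sF1 sAF).
split=> //.
- by split; apply: (line_modular_restr repg simM lineL); rewrite ?fsubsetIl ?fsubsetIr.
- exact: (binary_modular_join repg simM fl1 fl2 FA capg lineL).
- by have [] := properF.
- by split; apply: free_localization_flat.
Qed.
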